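(* Let $E\subset\mathbb{R}^3$ be a compact set (the conductor), let $q$ be a real number, let $0<k\le k(E)$, and let $l_k\in Ch(E,q)$ be the $k$-equilibrium distribution in $Ch(E,q)$. Then the potential function $U_k^{l_k}$ is constant inside the conductor, i.e. on the interior of $E$.
   Context: $\Im$ denotes the space of infinitely differentiable compactly supported real functions on $\mathbb{R}^3$, and $\Im^*$ the space of generalized functions (distributions), i.e. continuous linear functionals on $\Im$. For $l\in\Im^*$, $\mathrm{supp}(l)$ is the smallest closed set such that $l(\varphi)=0$ for every $\varphi\in\Im$ with $\mathrm{supp}(\varphi)\cap\mathrm{supp}(l)=\emptyset$. If $\mathrm{supp}(l)$ is compact, $l(\varphi)$ is defined in the natural way for every infinitely differentiable $\varphi$, not necessarily compactly supported; in particular $l(1)$ is defined. The Dirichlet class $\mathbf{D}$ is the Hilbert space obtained by completing $\Im$ in the norm $\|f\|_{\mathbf{D}}^2=\int_{\mathbb{R}^3}\|\nabla f\|^2\,dv$; its elements are (real) functions, identified when equal almost everywhere (so ''constant'' means equal almost everywhere to a constant), with generalized first-order partial derivatives in $L_2(\mathbb{R}^3)$. A generalized function $l$ belongs to $\mathbf{D}^*$ if there is $M<\infty$ with $|l(\varphi)|\le M\|\varphi\|_{\mathbf{D}}$ for all $\varphi\in\mathbf{D}$ ($l$ being extended by continuity from $\Im$ to $\mathbf{D}$). For a compact set $F\subset\mathbb{R}^3$ and real $q$, $Ch(F,q)$ is the set of all $l\in\mathbf{D}^*$ with $\mathrm{supp}(l)\subseteq F$ and $l(1)=q$. For a set $F$,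 $k(F)>0$ is the greatest number such that $k^2(F)\int_F|f|^2\,dv\le\frac{1}{4\pi}\int_{\mathbb{R}^3}\|\nabla f\|^2\,dv$ for every $f\in\mathbf{D}$ (with $k(F)=+\infty$ if the inequality holds with every number in place of $k(F)$). For $f,g\in\mathbf{D}$ put $(f,g)_k=\frac{1}{4\pi}\int_{\mathbb{R}^3}(\nabla f,\nabla g)\,dv-k^2\int_E f g\,dv$. The $k$-potential function of $l\in\mathbf{D}^*$ is the unique function $U_k^l\in\mathbf{D}$ such that $l(\varphi)=(\varphi,U_k^l)_k$ for all $\varphi\in\mathbf{D}$; it is a standing assumption that this function exists and is unique for every $l\in\mathbf{D}^*$. The $k$-potential energy of $l\in\mathbf{D}^*$ is $W_k(l)=l(U_k^l)=(U_k^l,U_k^l)_k$. A distribution $l_k\in Ch(E,q)$ is the $k$-equilibrium distribution in $Ch(E,q)$ if $W_k(l_k)=\inf\{W_k(l):\ l\in Ch(E,q)\}$. *)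

(* Defs.v *)
From HB Require Import structures.
From mathcomp Require Import all_boot all_order all_algebra.
From mathcomp Require Import all_classical all_reals all_analysis.

Set Implicit Arguments.
Unset Strict Implicit.
Unset Printing Implicit Defensive.

Import Order.TTheory GRing.Theory Num.Theory.
Import numFieldNormedType.Exports.

Local Open Scope classical_set_scope.
Local Open Scope ring_scope.

(* The topology of R3 is the product topology; its library norm is the sup    *)
(* norm, so Euclidean lengths of gradients are always spelled out below.      *)
Notation R3 R := (R * R * R)%type.

(* The same carrier, with the Borel structure on which lebesgue_measure is    *)
(* defined.                                                                   *)
Notation mR3 R :=
  (measurableTypeR R * measurableTypeR R * measurableTypeR R)%type.

Definition leb3 (R : realType) : {measure set (mR3 R) -> \bar R} :=
  ((@lebesgue_measure R \x @lebesgue_measure R) \x @lebesgue_measure R)%E.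

Section generalized_functions.
Context {R : realType}.

Definition basis3 (i : 'I_3) : R3 R :=
  ((i == 0 :> nat)%:R, (i == 1 :> nat)%:R, (i == 2 :> nat)%:R).

Definition partial (i : 'I_3) (f : R3 R -> R) : R3 R -> R := 'D_(basis3 i) f.

Definition partials (s : seq 'I_3) (f : R3 R -> R) : R3 R -> R :=
  foldr partial f s.

Definition smooth (f : R3 R -> R) : Prop := forall s,
  continuous (partials s f) /\
  forall i x, derivable (partials s f) x (basis3 i).

Definition fsupp (f : R3 R -> R) : set (R3 R) := closure [set x | f x != 0].

Definition test (f : R3 R -> R) : Prop := smooth f /\ compact (fsupp f).

Definition test_cvg (phi : nat -> R3 R -> R) (f : R3 R -> R) : Prop :=
  (exists2 K, compact K & forall n, fsupp (phi n) `<=` K) /\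
  forall s, {uniform, (fun n => partials s (phi n)) @ \oo --> partials s f}.

(* Functionals are total maps on functions; only their values on a given      *)
(* class of functions (test functions, resp. the Dirichlet class) matter.     *)
Definition functional : Type := (R3 R -> R) -> R.

Definition linear_on (C : set (R3 R -> R)) (l : functional) : Prop :=
  forall (a : R) f g, C f -> C g ->
    l (fun x => a * f x + g x) = a * l f + l g.

Definition distribution (l : functional) : Prop :=
  linear_on test l /\
  forall phi f, (forall n, test (phi n)) -> test f -> test_cvg phi f ->
    l (phi n) @[n --> \oo] --> l f.

Definition dsupp (l : functional) : set (R3 R) :=
  smallest (fun S => closed S /\
    forall phi, test phi -> fsupp phi `&` S = set0 -> l phi = 0) set0.

(* For l of compact support, the value on an arbitrary smooth f is l (chi f)  *)
(* for any test function chi equal to 1 near the support of l.                *)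
Definition cutoff (A : set (R3 R)) (chi : R3 R -> R) : Prop :=
  test chi /\ A `<=` interior [set x | chi x = 1].

Definition smooth_pairing (l : functional) (f : R3 R -> R) : R :=
  let chi := xget (fun=> 0) (cutoff (dsupp l)) in l (fun x => chi x * f x).

End generalized_functions.

Section dirichlet_class.
Context {R : realType}.
Local Notation mu := (leb3 R).
Implicit Types (f g : R3 R -> R) (l L : @functional R).

Definition weak_gradient f (G : 'I_3 -> R3 R -> R) : Prop := forall i,
  [/\ measurable_fun [set: mR3 R] (G i),
      (\int[mu]_x ((G i x) ^+ 2)%:E < +oo)%E &
      forall phi, test phi ->
        \int[mu]_x (f x * partial i phi x) = - \int[mu]_x (G i x * phi x)].

Definition grad f : 'I_3 -> R3 R -> R := xget (fun _ _ => 0) (weak_gradient f).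

Definition dirichlet_energy f : \bar R :=
  (\int[mu]_x (\sum_(i < 3) grad f i x ^+ 2)%:E)%E.

(* The completion of the test functions in the Dirichlet norm, realised as a  *)
(* class of functions. A Cauchy sequence of test functions determines its     *)
(* gradients' limit in L^2 and (by the Sobolev inequality in dimension 3)     *)
(* its own limit in L^2 on every compact set; requiring the latter            *)
(* convergence fixes the additive constant that the norm does not see.        *)
Definition dirichlet f : Prop :=
  [/\ measurable_fun [set: mR3 R] f,
      exists G, weak_gradient f G &
      exists phi : nat -> R3 R -> R,
      [/\ forall n, test (phi n),
          (\int[mu]_x (\sum_(i < 3) (partial i (phi n) x - grad f i x) ^+ 2)%:E
             @[n --> \oo] --> 0)%E &
          forall K, compact K ->
            (\int[mu]_(x in K) ((phi n x - f x) ^+ 2)%:E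
               @[n --> \oo] --> 0)%E]].

Definition dirichlet_norm f : R := Num.sqrt (fine (dirichlet_energy f)).

Definition continuous_extension l L : Prop :=
  [/\ forall phi, test phi -> L phi = l phi,
      linear_on dirichlet L &
      exists M, forall f, dirichlet f -> `|L f| <= M * dirichlet_norm f].

Definition dirichlet_dual l : Prop :=
  distribution l /\ exists L, continuous_extension l L.

Definition extension l : functional := xget (fun=> 0) (continuous_extension l).

Definition Ch (F : set (R3 R)) (q : R) : set functional :=
  [set l | [/\ dirichlet_dual l, dsupp l `<=` F &
               smooth_pairing l (fun=> 1) = q]].

(* The supremum is attained whenever it is finite. *)
Definition kmax (F : set (R3 R)) : \bar R :=
  ereal_sup (EFin @` [set k : R | forall f, dirichlet f ->
    ((k ^+ 2)%:E * \int[mu]_(x in F) (`|f x| ^+ 2)%:E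
       <= ((4 * pi)^-1)%:E * dirichlet_energy f)%E]).

Definition kform (k : R) (E : set (R3 R)) f g : R :=
  (4 * pi)^-1 * \int[mu]_x (\sum_(i < 3) grad f i x * grad g i x)
  - k ^+ 2 * \int[mu]_(x in E) (f x * g x).

Definition is_potential (k : R) (E : set (R3 R)) l (U : R3 R -> R) : Prop :=
  dirichlet U /\ forall phi, dirichlet phi -> extension l phi = kform k E phi U.

Definition potential (k : R) (E : set (R3 R)) l : R3 R -> R :=
  xget (fun=> 0) (is_potential k E l).

Definition potential_energy (k : R) (E : set (R3 R)) l : R :=
  extension l (potential k E l).

Definition equilibrium (k : R) (E : set (R3 R)) (q : R) l : Prop :=
  Ch E q l /\
  (potential_energy k E l)%:E =
    ereal_inf [set (potential_energy k E l')%:E | l' in Ch E q].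

(* Existence of the k-potential of every l in D*, and uniqueness as an        *)
(* element of D, i.e. up to equality almost everywhere.                       *)
Definition potentials_exist_unique (k : R) (E : set (R3 R)) : Prop :=
  forall l, dirichlet_dual l ->
  exists U, is_potential k E l U /\
    forall V, is_potential k E l V -> {ae mu, forall x, V x = U x}.

End dirichlet_class.

(* Main.v *)
Require Import Defs.
From HB Require Import structures.
From mathcomp Require Import all_boot all_order all_algebra.
From mathcomp Require Import all_classical all_reals all_analysis.
From mathcomp Require Import measurable_realfun ring lra.

Import Order.TTheory GRing.Theory Num.Theory.
Import numFieldNormedType.Exports.

Local Open Scope classical_set_scope.
Local Open Scope ring_scope.

Set Implicit Arguments.
Unset Strict Implicit.
Unset Printing Implicit Defensive.

(** The energy of [lk + t m] is a quadratic polynomial in [t]; minimality of [lk]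
    therefore makes every [m] of total charge 0 carried by [E] orthogonal to the
    potential [U]. Let [b] and [b'] be tensor products of one-variable plateau
    functions supported in the interior of [E], and let [M] and [M'] be the
    products of the integrals of their factors. In one variable
    [m' p - m p'] has a compactly supported primitive, so by telescoping
    [M' b - M b'] is the divergence of a compactly supported smooth field. Such a
    density has total charge 0 and pairs with [f] through the weak gradient of
    [f], which puts it in the dual of the Dirichlet class. Hence the integrals of
    [U b] and of [b] are proportional, with one constant for all bumps, whatever
    connected component of the interior they live in. Letting the bumps increase
    to indicators of boxes gives [U = c] almost everywhere. *)

(** The field with divergence [M' b - M b'] may leave [E]: admissibility restricts its divergence
    alone, so the field can cross the gap between two components, and one constant serves the whole
    interior. Divergence form also settles membership in the dual: for a general smooth density that
    would rest on the Sobolev inequality, whereas a pairing with the weak gradient is bounded by the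
    Dirichlet norm through an elementary square inequality. Gradient, extension, cutoff and
    potential are all picked by [xget], so each choice has to be tamed: weak gradients are unique
    almost everywhere, extensions by density of test functions, the total charge by comparing
    cutoffs, and potentials enter through their defining identity and the symmetry of the form. That
    [M] is the integral of [b] would be Fubini's theorem; instead, the integral of the same
    divergence being 0 shows that integrals of bumps are in the ratio of their masses, and the
    constant appears as the mean of [U] over one reference bump. *)

Local Notation i0 := (@Ordinal 3 0 isT).
Local Notation i1 := (@Ordinal 3 1 isT).
Local Notation i2 := (@Ordinal 3 2 isT).

(** * Smooth functions of one variable *)

Section one_variable.
Context {R : realType}.
Implicit Types (f g p : R -> R) (x : R).

(* The factor [x ^- k] makes the family closed under differentiation. *)
Definition flat (k : nat) x : R :=
  if 0 < x then x ^- k * expR (- x^-1) else 0.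

Lemma flat_ge0 k x : 0 <= flat k x.
Proof.
rewrite /flat; case: ifPn => // x0.
by rewrite mulr_ge0 ?expR_ge0// invr_ge0 exprn_ge0// ltW.
Qed.

Lemma flat_gt0 k x : 0 < x -> 0 < flat k x.
Proof.
by move=> x0; rewrite /flat x0 mulr_gt0 ?expR_gt0// invr_gt0 exprn_gt0.
Qed.

Lemma flat_le0 k x : x <= 0 -> flat k x = 0.
Proof. by rewrite /flat ltNge => ->. Qed.

(** The term of degree [k.+1] of the exponential series at [x^-1] absorbs [x ^- k] and leaves a
    factor [x], which gives continuity at 0 for every [k] at once. *)
Lemma flat_le k x : 0 < x -> flat k x <= k.+1`!%:R * x.
Proof.
move=> x0; rewrite /flat x0 expRN.
have y0 : 0 < x^-1 by rewrite invr_gt0.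
have := expR_ge1Dxn k (ltW y0).
have := expR_gt0 x^-1.
set e := expR _ => e0.
have f0 : (0 : R) < k.+1`!%:R by rewrite ltr0n fact_gt0.
have xk0 : 0 < x ^+ k by rewrite exprn_gt0.
move=> H.
have {H} : x^-1 ^+ k.+1 / k.+1`!%:R <= e by lra.
rewrite ler_pdivrMr// exprVn exprS invfM => H.
rewrite ler_pdivrMr// -(ler_pM2l y0).
apply: (le_trans H).
by rewrite (mulrC k.+1`!%:R) -!mulrA mulKf ?gt_eqF// mulrC.
Qed.

Lemma is_derive_flat k x :
  is_derive x (1 : R) (flat k) (- k%:R * flat k.+1 x + flat k.+2 x).
Proof.
have [x0|x0|->] := ltgtP x 0.
- rewrite !flat_le0 ?ltW// mulr0 addr0.
  apply: (near_eq_is_derive (f := cst (0 : R))).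
  near=> y; rewrite flat_le0// ltW//; near: y; exact: lt_nbhsl.
- have xN0 : x != 0 by rewrite gt_eqF.
  apply: (near_eq_is_derive (f := (fun y : R => (y ^+ k)^-1) * (expR \o (fun y : R => - y^-1)))).
    by near=> y; rewrite /flat ifT//; near: y; exact: lt_nbhsr.
  apply: is_derive_eq.
    apply: is_deriveM.
      apply: is_deriveV; first by rewrite expf_neq0.
      have -> : (fun y : R => y ^+ k) = id ^+ k by apply/funext => y; rewrite exprfctE.
      exact: is_deriveX.
    apply: is_derive1_comp.
    apply: is_deriveN.
    apply: is_deriveV => //.
  rewrite /= /flat x0 /GRing.scale/=.
  have xkn : x ^+ k != 0 by rewrite expf_neq0.
  case: k xkn => [|k] xkn.
    by rewrite expr0 !exprS expr0; field.
  by rewrite /= !exprS; field; rewrite xN0 expf_neq0.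
(* At 0 the difference quotient of [flat k] is [flat k.+1], which tends to 0 by [flat_le]. *)
- apply/is_derive1_caratheodory; exists (flat k.+1); split.
  + move=> z; rewrite (@flat_le0 k 0)// !subr0 /flat.
    case: ifPn => [z0|]; last by rewrite mul0r.
    by rewrite exprS; field; rewrite expf_neq0// gt_eqF.
  + rewrite /prop_for /continuous_at flat_le0//.
    apply/cvgrPdist_le => /= e e0.
    have C0 : (0 : R) < k.+2`!%:R by rewrite ltr0n fact_gt0.
    near=> y; rewrite sub0r normrN ger0_norm ?flat_ge0//.
    have [y0|y0] := leP y 0; first by rewrite flat_le0// ltW.
    apply: (le_trans (flat_le _ y0)).
    rewrite mulrC -ler_pdivlMr//; apply: ltW; near: y.
    by apply: lt_nbhsl; rewrite divr_gt0.
  + by rewrite !flat_le0// mulr0 addr0.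
Unshelve. all: by end_near. Qed.

(* A class of functions closed under differentiation, see [smooth1_derive]. *)
Inductive smooth1 : (R -> R) -> Prop :=
| smooth1_cst c : smooth1 (fun=> c)
| smooth1_flat k : smooth1 (flat k)
| smooth1_affine a b f : smooth1 f -> smooth1 (fun x => f (a * x + b))
| smooth1D f g : smooth1 f -> smooth1 g -> smooth1 (fun x => f x + g x)
| smooth1M f g : smooth1 f -> smooth1 g -> smooth1 (fun x => f x * g x)
| smooth1V f : (forall x, f x != 0) -> smooth1 f -> smooth1 (fun x => (f x)^-1)
| smooth1_primitive f g : smooth1 g -> (forall x, is_derive x (1 : R) f (g x)) ->
    smooth1 f.

Lemma smooth1_derive f : smooth1 f ->
  exists2 f', smooth1 f' & forall x, is_derive x (1 : R) f (f' x).
Proof.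
elim => {f} [c|k|a b f _ [f' sf' df]|f g sf [f' sf' df] sg [g' sg' dg]
  |f g sf [f' sf' df] sg [g' sg' dg]|f f0 sf [f' sf' df]|f g sg _ df].
- by exists (fun=> 0); [exact: smooth1_cst|move=> x; exact: is_derive_cst].
- exists (fun x => - k%:R * flat k.+1 x + flat k.+2 x) => [|x].
    apply: smooth1D; last exact: smooth1_flat.
    by apply: smooth1M; [exact: smooth1_cst|exact: smooth1_flat].
  exact: is_derive_flat.
- exists (fun x => f' (a * x + b) * a).
    by apply: smooth1M; [exact: smooth1_affine|exact: smooth1_cst].
  move=> x.
  have H : is_derive x (1 : R) (fun y => a * y + b) a.
    have -> : (fun y => a * y + b) = (a \*: id) + cst b by [].
    by apply: is_derive_eq; rewrite addr0 /GRing.scale/= mulr1.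
  exact: (@is_derive1_comp _ f _ x _ _ (df _) H).
- exists (fun x => f' x + g' x); first exact: smooth1D.
  by move=> x; exact: is_deriveD.
- exists (fun x => f x * g' x + g x * f' x).
    by apply: smooth1D; exact: smooth1M.
  by move=> x; exact: is_deriveM.
- exists (fun x => - 1 * ((f x)^-1 * (f x)^-1) * f' x).
    apply: smooth1M => //; apply: smooth1M; first exact: smooth1_cst.
    by apply: smooth1M; exact: smooth1V.
  move=> x; apply: (is_derive_eq (is_deriveV (f0 x) (df x))).
  by rewrite /GRing.scale/= expr2 invfM mulN1r.
- by exists g.
Qed.

Lemma smooth1_continuous f : smooth1 f -> continuous f.
Proof.
move=> /smooth1_derive[f' _ df] x.
by apply: differentiable_continuous; apply/derivable1_diffP; case: (df x).
Qed.

(** The classical smooth transition from 0 to 1 on the unit interval. The denominator is positive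
    because [x] or [1 - x] is. *)
Definition step x : R := flat 0 x / (flat 0 x + flat 0 (1 - x)).

Lemma step_den x : 0 < flat 0 x + flat 0 (1 - x).
Proof.
have [x0|x0] := leP x 0.
  by rewrite ltr_wpDl ?flat_ge0 ?flat_gt0//; lra.
by rewrite ltr_pwDl ?flat_ge0 ?flat_gt0.
Qed.

Lemma smooth1_step : smooth1 step.
Proof.
apply: smooth1M; first exact: smooth1_flat.
apply: smooth1V; first by move=> x; rewrite gt_eqF ?step_den.
apply: smooth1D; first exact: smooth1_flat.
have -> : (fun x : R => flat 0 (1 - x)) = fun x => flat 0 (-1 * x + 1).
  by apply/funext => x; congr flat; ring.
exact/smooth1_affine/smooth1_flat.
Qed.

Lemma step_ge0 x : 0 <= step x.
Proof. by rewrite divr_ge0 ?flat_ge0// ltW ?step_den. Qed.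

Lemma step_le1 x : step x <= 1.
Proof. by rewrite ler_pdivrMr ?step_den// mul1r lerDl flat_ge0. Qed.

Lemma step_le0 x : x <= 0 -> step x = 0.
Proof. by move=> x0; rewrite /step flat_le0// mul0r. Qed.

Lemma step_ge1 x : 1 <= x -> step x = 1.
Proof.
move=> x1; rewrite /step (@flat_le0 _ (1 - x)) ?addr0 ?divff ?subr_le0//.
by rewrite gt_eqF// flat_gt0// (lt_le_trans _ x1).
Qed.

(** [s] is a steepness: each flank has width [s^-1] and lies inside []a, b[], so the function tends
    pointwise to the indicator of the open interval as [s] grows. *)
Definition plateau (s a b x : R) : R := step (s * (x - a)) * step (s * (b - x)).

Lemma smooth1_plateau s a b : smooth1 (plateau s a b).
Proof.
apply: smooth1M.
  have -> : (fun x => step (s * (x - a))) = fun x => step (s * x + - (s * a)).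
    by apply/funext => x; congr step; ring.
  exact/smooth1_affine/smooth1_step.
have -> : (fun x => step (s * (b - x))) = fun x => step (- s * x + s * b).
  by apply/funext => x; congr step; ring.
exact/smooth1_affine/smooth1_step.
Qed.

Lemma plateau_ge0 s a b x : 0 <= plateau s a b x.
Proof. by rewrite mulr_ge0 ?step_ge0. Qed.

Lemma plateau_le1 s a b x : plateau s a b x <= 1.
Proof. by rewrite mulr_ile1 ?step_ge0 ?step_le1. Qed.

Lemma plateau_out s a b x : 0 <= s -> ~~ (a < x < b) -> plateau s a b x = 0.
Proof.
move=> s0; rewrite negb_and -!leNgt => /orP[xa|bx]; rewrite /plateau.
  by rewrite step_le0 ?mul0r// mulr_ge0_le0// subr_le0.
by rewrite (@step_le0 (s * (b - x))) ?mulr0// mulr_ge0_le0// subr_le0.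
Qed.

Lemma plateau_in s a b x : 0 < s -> a + s^-1 <= x <= b - s^-1 ->
  plateau s a b x = 1.
Proof.
move=> s0 /andP[ax xb]; rewrite /plateau !step_ge1 ?mulr1//;
  by rewrite -ler_pdivrMl// mulr1; lra.
Qed.

End one_variable.

(** * Smooth functions of three variables *)

Section three_variables.
Context {R : realType}.
Implicit Types (f g : R3 R -> R) (x : R3 R) (i j : 'I_3).

(** The two difference quotients are the same function of [h]; directional derivatives thus reduce
    to calculus in one variable. *)
Lemma is_derive_line f x v t df :
  is_derive t (1 : R) (fun s : R => f (s *: v + x)) df <->
  is_derive (t *: v + x) v f df.
Proof.
have E : (fun h : R => h^-1 *: (((fun s : R => f (s *: v + x)) \o shift t) (h *: (1 : R))
     - f (t *: v + x))) = 
  (fun h : R => h^-1 *: ((f \o shift (t *: v + x)) (h *: v) - f (t *: v + x))).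
  apply/funext => h /=; congr (_ *: (f _ - _)).
  by rewrite [h *: 1]mulr1 scalerDl addrA.
split=> -[H1 H2].
  have H1' : derivable f (t *: v + x) v by rewrite /derivable -E.
  by split=> //; rewrite -H2 /derive E.
have H1' : derivable (fun s : R => f (s *: v + x)) t 1 by rewrite /derivable E.
by split=> //; rewrite -H2 /derive E.
Qed.

Definition proj3 i x : R :=
  match val i with 0 => x.1.1 | 1 => x.1.2 | _ => x.2 end.

Lemma proj3_line i j (t : R) x :
  proj3 j (t *: basis3 i + x) = (i == j)%:R * t + proj3 j x.
Proof.
case: x => -[a b] c.
by case: i => -[|[|[|//]]] ?; case: j => -[|[|[|//]]] ? /=;
  rewrite /proj3 /= /GRing.scale/= ?mulr1 ?mulr0 ?mul1r ?mul0r.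
Qed.

Lemma proj3_continuous i : continuous (proj3 i).
Proof.
move=> x; rewrite /proj3; case: i => -[|[|[|//]]] ?; rewrite /continuous_at/=.
- apply: (@continuous_comp _ _ _ fst fst); exact: cvg_fst.
- by apply: (@continuous_comp _ _ _ fst snd); [exact: cvg_fst|exact: cvg_snd].
- exact: cvg_snd.
Qed.

Lemma smooth_partial f i : smooth f -> smooth (partial i f).
Proof. by move=> sf s; rewrite /partials -[partial i f]/(foldr partial f [:: i]) -foldr_cat; exact: sf. Qed.

Lemma smooth_continuous f : smooth f -> continuous f.
Proof. by move=> /(_ [::]) []. Qed.

Lemma smooth_is_derive f i x : smooth f -> is_derive x (basis3 i) f (partial i f x).
Proof. by move=> /(_ [::]) [_ d]; apply/derivableP; exact: d. Qed.

Lemma is_derive_proj3 (h h' : R -> R) i j x : (forall t, is_derive t (1 : R) h (h' t)) ->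
  is_derive x (basis3 i) (h \o proj3 j) ((i == j)%:R * h' (proj3 j x)).
Proof.
move=> dh.
have -> : x = (0 : R) *: basis3 i + x by rewrite scale0r add0r.
  apply/is_derive_line.
  have -> : (fun s : R => (h \o proj3 j) (s *: basis3 i + x)) =
    (h \o (fun s => (i == j)%:R * s + proj3 j x)).
    by apply/funext => s /=; rewrite proj3_line.
  rewrite mulrC; apply: is_derive1_comp; first by rewrite proj3_line; exact: dh.
  have -> : (fun y : R => (i == j)%:R * y + proj3 j x) =
    (((i == j)%:R : R) \*: id) + cst (proj3 j x) by [].
  by apply: is_derive_eq; rewrite addr0 /GRing.scale/= mulr1.
Qed.

(** [smooth] quantifies over all iterated partial derivatives, and the Leibniz rule turns a product
    into a sum of products. An algebra closed under every [partial i] is the invariant that survives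
    the induction on the list of derivatives. *)
Inductive smooth_alg : (R3 R -> R) -> Prop :=
| smooth_alg_smooth f : smooth f -> smooth_alg f
| smooth_alg_proj3 i h : smooth1 h -> smooth_alg (h \o proj3 i)
| smooth_algD f g : smooth_alg f -> smooth_alg g -> smooth_alg (fun x => f x + g x)
| smooth_algM f g : smooth_alg f -> smooth_alg g -> smooth_alg (fun x => f x * g x).

Lemma smooth_alg_derive f i : smooth_alg f ->
  exists2 f', smooth_alg f' & forall x, is_derive x (basis3 i) f (f' x).
Proof.
elim => {f} [f sf|j h /smooth1_derive[h' sh' dh]|f g sf [f' sf' df] sg [g' sg' dg]
  |f g sf [f' sf' df] sg [g' sg' dg]].
- exists (partial i f) => [|x].
    exact/smooth_alg_smooth/smooth_partial.
  exact: smooth_is_derive.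
- exists (fun x => (i == j)%:R * h' (proj3 j x)).
    apply: smooth_algM; last exact: smooth_alg_proj3.
    have /(smooth_alg_proj3 ord0) := @smooth1_cst R (i == j)%:R.
    exact.
  by move=> x; exact: is_derive_proj3.
- exists (fun x => f' x + g' x); first exact: smooth_algD.
  by move=> x; exact: is_deriveD.
- exists (fun x => f x * g' x + g x * f' x).
    by apply: smooth_algD; exact: smooth_algM.
  by move=> x; exact: is_deriveM.
Qed.

Lemma smooth_alg_continuous f : smooth_alg f -> continuous f.
Proof.
elim => {f} [f /smooth_continuous//|j h sh x|f g _ cf _ cg x|f g _ cf _ cg x].
- apply: continuous_comp; first exact: proj3_continuous.
  exact: smooth1_continuous.
- by apply: continuousD; [exact: cf|exact: cg].
- by apply: continuousM; [exact: cf|exact: cg].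
Qed.

Lemma smooth_alg_sub f : smooth_alg f -> smooth f.
Proof.
move=> af s.
suff H : smooth_alg (partials s f).
  split; first exact: smooth_alg_continuous.
  by move=> i x; have [f' _ /(_ x)[]] := smooth_alg_derive i H.
elim: s => //= i s IH.
have [f' af' df] := smooth_alg_derive i IH.
suff -> : partial i (foldr partial f s) = f' by [].
by apply/funext => x; have [_] := df x.
Qed.

Lemma smoothD f g : smooth f -> smooth g -> smooth (fun x => f x + g x).
Proof.
by move=> sf sg; apply/smooth_alg_sub/smooth_algD; exact: smooth_alg_smooth.
Qed.

Lemma smoothM f g : smooth f -> smooth g -> smooth (fun x => f x * g x).
Proof.
by move=> sf sg; apply/smooth_alg_sub/smooth_algM; exact: smooth_alg_smooth.
Qed.

Lemma smooth_proj3 i h : smooth1 h -> smooth (h \o proj3 i).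
Proof. by move=> sh; exact/smooth_alg_sub/smooth_alg_proj3. Qed.

Lemma smooth_cst (c : R) : smooth (fun=> c).
Proof. exact: (smooth_proj3 ord0 (smooth1_cst c)). Qed.

Lemma smoothZ (c : R) f : smooth f -> smooth (fun x => c * f x).
Proof. by apply: smoothM; exact: smooth_cst. Qed.

Lemma partialM f g i : smooth f -> smooth g ->
  partial i (fun x => f x * g x) = fun x => f x * partial i g x + g x * partial i f x.
Proof.
move=> sf sg; apply/funext => x.
have [_] := is_deriveM (smooth_is_derive i x sf) (smooth_is_derive i x sg).
exact.
Qed.

Lemma partialD f g i : smooth f -> smooth g ->
  partial i (fun x => f x + g x) = fun x => partial i f x + partial i g x.
Proof.
move=> sf sg; apply/funext => x.
have [_] := is_deriveD (smooth_is_derive i x sf) (smooth_is_derive i x sg).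
exact.
Qed.

Lemma partial_cst (c : R) i : partial i (fun=> c) = fun=> 0.
Proof.
by apply/funext => x; have [_] := is_derive_cst c x (basis3 i).
Qed.

Lemma partialZ c f i : smooth f ->
  partial i (fun x => c * f x) = fun x => c * partial i f x.
Proof.
move=> sf; rewrite partialM//; last exact: smooth_cst.
by apply/funext => x; rewrite partial_cst mulr0 addr0.
Qed.

Lemma partial_proj3 (h h' : R -> R) i j : (forall t, is_derive t (1 : R) h (h' t)) ->
  partial i (h \o proj3 j) = fun x => (i == j)%:R * h' (proj3 j x).
Proof.
by move=> dh; apply/funext => x; have [_] := is_derive_proj3 i j x dh.
Qed.

End three_variables.

(** * Topology and Lebesgue measure *)

Section measure_topology.
Context {R : realType}.
Local Notation mu := (leb3 R).
Implicit Types (f g : R3 R -> R) (x : R3 R) (i j : 'I_3).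

Lemma measurable_proj3 i : measurable_fun [set: mR3 R] (proj3 i : mR3 R -> R).
Proof.
case: i => -[|[|[|//]]] ?; rewrite /proj3/=.
- exact: (measurableT_comp measurable_fst measurable_fst).
- exact: (measurableT_comp measurable_snd measurable_fst).
- exact: measurable_snd.
Qed.

Lemma ball_proj3 x (e : R) y :
  ball x e y <-> forall i, `|proj3 i x - proj3 i y| < e.
Proof.
case: x => -[x1 x2] x3; case: y => -[y1 y2] y3; split.
  by move=> [[/= ? ?] ?] [[|[|[|//]]] ?].
move=> H; split; first split.
- exact: (H (@Ordinal 3 0 isT)).
- exact: (H (@Ordinal 3 1 isT)).
- exact: (H (@Ordinal 3 2 isT)).
Qed.

Lemma ord3P (P : 'I_3 -> Prop) : (forall i, P i) <-> [/\ P i0, P i1 & P i2].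
Proof.
split=> [H|[H0 H1 H2] [[|[|[|//]]] p]]; first by split; exact: H.
- by rewrite (_ : Ordinal p = i0)//; exact/val_inj.
- by rewrite (_ : Ordinal p = i1)//; exact/val_inj.
- by rewrite (_ : Ordinal p = i2)//; exact/val_inj.
Qed.

Lemma proj3_inj x y : (forall i, proj3 i x = proj3 i y) -> x = y.
Proof.
by case: x => -[x1 x2] x3; case: y => -[y1 y2] y3 /ord3P[]; rewrite /proj3/= => -> -> ->.
Qed.

Definition obox (a b : 'I_3 -> R) : set (R3 R) :=
  [set x | forall i, a i < proj3 i x < b i].

Lemma oboxE a b : obox a b = proj3 i0 @^-1` `]a i0, b i0[%classic `&`
  proj3 i1 @^-1` `]a i1, b i1[%classic `&` proj3 i2 @^-1` `]a i2, b i2[%classic.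
Proof.
apply/seteqP; split=> x; rewrite /= !in_itv/=.
  by move=> H; split; [split|]; exact: H.
by move=> [[? ?] ?]; exact/ord3P.
Qed.

Lemma measurable_obox a b : measurable (obox a b : set (mR3 R)).
Proof.
have H i : measurable (proj3 i @^-1` `]a i, b i[%classic : set (mR3 R)).
  have := @measurable_proj3 i measurableT _ (measurable_itv `]a i, b i[).
  by rewrite setTI.
rewrite oboxE; apply: measurableI; last exact: H.
by apply: measurableI; exact: H.
Qed.

Lemma open_obox a b : open (obox a b : set (R3 R)).
Proof.
have H i : open (proj3 i @^-1` `]a i, b i[%classic : set (R3 R)).
  by apply: open_comp => // x _; exact: proj3_continuous.
by rewrite oboxE; apply: openI; [apply: openI|]; exact: H.
Qed.

Lemma nbhs_obox (U : set (R3 R)) x : nbhs x U ->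
  exists2 d : R, 0 < d & [set y | forall i, `|proj3 i x - proj3 i y| < d] `<=` U.
Proof.
move=> /nbhs_ballP[e /= e0 eU]; exists e => // y yx.
by apply: eU; exact/ball_proj3.
Qed.

Definition cbox (a b : 'I_3 -> R) : set (R3 R) :=
  [set x | forall i, a i <= proj3 i x <= b i].

Lemma obox_sub_cbox a b : obox a b `<=` cbox a b.
Proof. by move=> x H i; have /andP[/ltW -> /ltW ->] := H i. Qed.

Lemma cboxE a b : cbox a b = proj3 i0 @^-1` `[a i0, b i0]%classic `&`
  proj3 i1 @^-1` `[a i1, b i1]%classic `&` proj3 i2 @^-1` `[a i2, b i2]%classic.
Proof.
apply/seteqP; split=> x; rewrite /= !in_itv/=.
  by move=> H; split; [split|]; exact: H.
by move=> [[? ?] ?]; exact/ord3P.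
Qed.

Lemma compact_cbox a b : compact (cbox a b : set (R3 R)).
Proof.
have -> : cbox a b = (`[a i0, b i0]%classic `*` `[a i1, b i1]%classic) `*`
    `[a i2, b i2]%classic by rewrite cboxE.
apply: compact_setX; last exact: segment_compact.
by apply: compact_setX; exact: segment_compact.
Qed.

Lemma closed_cbox a b : closed (cbox a b : set (R3 R)).
Proof. by apply: compact_closed; [exact: norm_hausdorff|exact: compact_cbox]. Qed.

(** Rational corners make the family of boxes countable. The closed box inside [U] leaves room for
    the support of a bump, while the open one contains the point. *)
Lemma open_rat_cbox (U : set (R3 R)) x : open U -> U x ->
  exists2 q : {ffun 'I_3 -> rat * rat},
    obox (fun i => ratr (q i).1) (fun i => ratr (q i).2) x &
    cbox (fun i => ratr (q i).1) (fun i => ratr (q i).2) `<=` U.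
Proof.
move=> oU Ux; have [d d0 dU] := nbhs_obox (oU x Ux).
have H1 i : exists p : rat * rat, [/\ proj3 i x - d < ratr p.1, ratr p.1 < proj3 i x,
   proj3 i x < ratr p.2 & ratr p.2 < proj3 i x + d].
  have [|p] := @rat_in_itvoo R (proj3 i x - d) (proj3 i x).
    by rewrite ltrBlDr ltrDl.
  rewrite in_itv/= => /andP[p1 p2].
  have [|r] := @rat_in_itvoo R (proj3 i x) (proj3 i x + d).
    by rewrite ltrDl.
  rewrite in_itv/= => /andP[r1 r2].
  by exists (p, r).
have [p Hp] := choice H1.
exists (finfun p) => [i|y By]; first by rewrite !ffunE; have [_ -> -> _] := Hp i.
apply: dU => i; have := By i; have := Hp i; rewrite !ffunE => -[? ? ? ?] /andP[? ?].
by rewrite distrC ltr_distl; apply/andP; split; lra.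
Qed.

(** The bridge between the product topology and the product sigma-algebra: an open set is a
    countable union of rational boxes. *)
Lemma open_measurable3 (U : set (R3 R)) : open U -> measurable (U : set (mR3 R)).
Proof.
move=> oU.
pose B (q : {ffun 'I_3 -> rat * rat}) : set (R3 R) :=
  obox (fun i => ratr (q i).1) (fun i => ratr (q i).2).
have -> : U = \bigcup_(q in [set q | B q `<=` U]) B q.
  apply/seteqP; split=> [x Ux|x [q /= qU qx]]; last exact: qU.
  have [q Bq Cq] := open_rat_cbox oU Ux.
  by exists q => //=; apply: subset_trans Cq; exact: obox_sub_cbox.
rewrite bigcup_mkcond; apply: (@countable_bigcupT_measurable _ (mR3 R)).
  exact: countableP.
by move=> q; case: ifPn => // _; exact: measurable_obox.
Qed.

Lemma closed_measurable3 (A : set (R3 R)) : closed A -> measurable (A : set (mR3 R)).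
Proof. by move=> /closed_openC/open_measurable3/measurableC; rewrite setCK. Qed.

Lemma compact_measurable3 (A : set (R3 R)) : compact A -> measurable (A : set (mR3 R)).
Proof. by move=> cA; apply: closed_measurable3; apply: compact_closed. Qed.

Lemma continuous_measurable3 f : continuous f ->
  measurable_fun [set: mR3 R] (f : mR3 R -> R).
Proof.
move=> cf; apply: (measurability _ (RGenOpens.measurableE R)).
move=> _ [_ [a [b ->] <-]]; rewrite setTI; apply: open_measurable3.
by apply: open_comp => [x _|]; [exact: cf|exact: interval_open].
Qed.

(** * Compact sets and local integrability *)

Definition cube (r : R) : set (R3 R) := [set x | forall i, `|proj3 i x| <= r].

Lemma cubeE r : cube r =
  (`[- r, r]%classic `*` `[- r, r]%classic) `*` `[- r, r]%classic.
Proof.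
apply/seteqP; split => -[[x1 x2] x3].
  by move=> /ord3P[]; rewrite /= /proj3/= !ler_norml !in_itv/=.
by rewrite /= !in_itv/= => -[[? ?] ?]; apply/ord3P; rewrite /proj3/= !ler_norml.
Qed.

Lemma compact_cube r : compact (cube r : set (R3 R)).
Proof.
rewrite cubeE; apply: compact_setX; last exact: segment_compact.
by apply: compact_setX; exact: segment_compact.
Qed.

Lemma measurable_cube r : measurable (cube r : set (mR3 R)).
Proof. by apply: compact_measurable3; exact: compact_cube. Qed.

Definition square (r : R) : set (measurableTypeR R * measurableTypeR R) :=
  `[- r, r]%classic `*` `[- r, r]%classic.

Lemma segment_finite (r : R) :
  (@lebesgue_measure R [set` `[(- r)%R, r]] < +oo)%E.
Proof.
by rewrite lebesgue_measure_itv/=; case: ifP => // _; rewrite -EFinD ltry.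
Qed.

Lemma square_finite (r : R) :
  ((@lebesgue_measure R \x @lebesgue_measure R) (square r) < +oo)%E.
Proof.
rewrite product_measure1E// lte_mul_pinfty ?ge0_fin_numE//; exact: segment_finite.
Qed.

Lemma cube_finite r : (mu (cube r) < +oo)%E.
Proof.
rewrite cubeE /leb3 [ltLHS]product_measure1E//; last exact: measurableX.
rewrite lte_mul_pinfty//; last exact: segment_finite.
by rewrite ge0_fin_numE//; exact: square_finite.
Qed.

Lemma compact_sub_cube (K : set (R3 R)) : compact K -> exists r, K `<=` cube r.
Proof.
move=> /compact_bounded[M [_ HM]]; exists (M + 1) => x /HM.
move=> /(_ (M + 1)); rewrite ltrDl ltr01 => /(_ isT) /= H i.
apply: le_trans H; case: x => -[x1 x2] x3.
rewrite !prod_normE/= !le_max /proj3.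
by case: i => -[|[|[|//]]] ?/=; rewrite lexx ?orbT.
Qed.

Lemma compact_finite3 (K : set (R3 R)) : compact K -> (mu K < +oo)%E.
Proof.
move=> cK; have [r Kr] := compact_sub_cube cK.
apply: le_lt_trans (cube_finite r); apply: le_measure => //; rewrite inE.
  exact: compact_measurable3.
exact: measurable_cube.
Qed.

Definition locally_integrable3 (f : R3 R -> R) :=
  measurable_fun [set: mR3 R] (f : mR3 R -> R) /\
  forall K : set (R3 R), compact K -> mu.-integrable (K : set (mR3 R)) (EFin \o f).

Lemma fsupp_out f x : ~ fsupp f x -> f x = 0.
Proof.
move=> Nfx; apply/eqP; apply: contra_notT Nfx => fx.
exact: subset_closure.
Qed.

Lemma continuous_bounded_compact f (K : set (R3 R)) : continuous f -> compact K ->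
  exists2 M, 0 < M & forall x, K x -> `|f x| <= M.
Proof.
move=> cf cK.
have /compact_bounded[M [_ HM]] : compact (f @` K).
  by apply: continuous_compact => //; exact: continuous_subspaceT.
exists (`|M| + 1) => [|x Kx]; first by rewrite ltr_wpDl.
by apply: HM; [rewrite ltr_pwDr// ler_norm|exists x].
Qed.

Lemma continuous_bounded f : continuous f -> compact (fsupp f) ->
  exists2 M, 0 < M & forall x, `|f x| <= M.
Proof.
move=> cf /(continuous_bounded_compact cf)[M M0 HM]; exists M => // x.
have [/HM//|/fsupp_out ->] := pselect (fsupp f x).
by rewrite normr0 ltW.
Qed.

Lemma integrable_locM f g : locally_integrable3 f -> continuous g ->
  compact (fsupp g) -> mu.-integrable setT (fun x : mR3 R => (f x * g x)%:E).
Proof.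
move=> [mf intf] cg sg.
have [M M0 HM] := continuous_bounded cg sg.
have ms := compact_measurable3 sg.
have -> : (fun x : mR3 R => (f x * g x)%:E) =
    (((EFin \o f) \* (EFin \o g)) \_ (fsupp g : set (mR3 R)))%E.
  apply/funext => x; rewrite patchE; case: ifPn => //= /negP.
  by rewrite inE => /fsupp_out ->; rewrite mulr0.
apply: (iffLR (integrable_mkcond _ ms)); apply: integrableMl => //; first exact: intf.
  by apply: measurable_funTS; exact: continuous_measurable3.
by exists M; split=> [|y My x _ /=]; [exact: num_real|exact: le_trans (HM x) (ltW My)].
Qed.

Lemma locally_integrable_continuous f : continuous f -> locally_integrable3 f.
Proof.
move=> cf; split; first exact: continuous_measurable3.
move=> K cK; apply: measurable_bounded_integrable.
- exact: compact_measurable3.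
- exact: compact_finite3.
- by apply: measurable_funTS; exact: continuous_measurable3.
- have [M M0 HM] := continuous_bounded_compact cf cK.
  by exists M; split=> [|y My x Kx /=]; [exact: num_real|exact: le_trans (HM x Kx) (ltW My)].
Qed.

Lemma integrable_continuous f : continuous f -> compact (fsupp f) ->
  mu.-integrable setT (fun x : mR3 R => (f x)%:E).
Proof.
move=> cf sf.
have -> : (fun x : mR3 R => (f x)%:E) = (fun x : mR3 R => (cst 1 x * f x)%:E).
  by apply/funext => x; rewrite mul1r.
apply: integrable_locM => //.
by apply: locally_integrable_continuous => x; exact: cvg_cst.
Qed.

End measure_topology.

(* The canonical sigma-finite structure of the library on a product measure is
   found only for subprobabilities, and Fubini's theorem needs one on the plane. *)
Definition leb2 (R : realType) : set (measurableTypeR R * measurableTypeR R) -> \bar R :=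
  (@lebesgue_measure R \x @lebesgue_measure R)%E.

Arguments leb2 R : clear implicits.

Section lebesgue_plane.
Context {R : realType}.

HB.instance Definition _ := Measure.on (leb2 R).

Lemma leb2_sigma_finite : sigma_finite setT (leb2 R).
Proof.
exists (fun n => square n%:R) => [|n].
  apply/seteqP; split=> // -[x y] _; exists (Num.truncn (Num.max `|x| `|y|)).+1 => //.
  have := truncnS_gt (Num.max `|x| `|y|); rewrite gt_max => /andP[/ltW hx /ltW hy].
  by rewrite /square/= !in_itv/= -!ler_norml.
by split; [exact: measurableX|exact: square_finite].
Qed.

HB.instance Definition _ :=
  Measure_isSigmaFinite.Build _ _ _ (leb2 R) leb2_sigma_finite.

End lebesgue_plane.

(** * Integration by parts *)

Section integration_by_parts.
Context {R : realType}.
Local Notation leb := (@lebesgue_measure R).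
Local Notation mu := (leb3 R).

Implicit Types (f g : R3 R -> R) (x : R3 R) (i j : 'I_3).

Lemma integrable_compact1 (p : R -> R) r : continuous p ->
  (forall t, ~~ (- r < t < r) -> p t = 0) -> leb.-integrable setT (EFin \o p).
Proof.
move=> cp p0.
have -> : EFin \o p = (EFin \o p) \_ `[- r, r]%classic.
  apply/funext => t; rewrite patchE; case: ifPn => //= /negP.
  rewrite inE/= in_itv/= => /negP H; rewrite p0//.
  by apply: contra H => /andP[/ltW -> /ltW].
apply: (iffLR (integrable_mkcond _ _)) => //.
apply: continuous_compact_integrable; first exact: segment_compact.
exact: continuous_subspaceT.
Qed.

Lemma integral_derive0 (h h' : R -> R) r : continuous h' ->
  (forall t, is_derive t (1 : R) h (h' t)) ->
  (forall t, ~~ (- r < t < r) -> h t = 0) ->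
  (forall t, ~~ (- r < t < r) -> h' t = 0) ->
  (\int[leb]_t (h' t)%:E = 0)%E.
Proof.
move=> ch' dh h0 h'0.
have [r0|r0] := leP r 0.
  rewrite integral0_eq// => t _; rewrite h'0//.
  by apply/negP => /andP[]; lra.
have dh1 t : derivable h t 1 by case: (dh t).
have ch t : {for t, continuous h}.
  by apply: differentiable_continuous; exact/derivable1_diffP.
have : (\int[leb]_(t in `[(- r)%R, r]) (h' t)%:E = (h r)%:E - (h (- r))%:E)%E.
  apply: continuous_FTC2; first by lra.
  - exact: continuous_subspaceT.
  - split; first by move=> t _; exact: dh1.
      by apply: cvg_at_right_filter; exact: ch.
    by apply: cvg_at_left_filter; exact: ch.
  - by move=> t _; rewrite derive1E; case: (dh t).
rewrite !h0 ?ltxx ?andbF// subee// => H.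
rewrite -[RHS]H [RHS]integral_mkcond; apply: eq_integral => t _.
rewrite patchE; case: ifPn => //= /negP.
rewrite inE/= in_itv/= => /negP H1; rewrite h'0//.
by apply: contra H1 => /andP[/ltW -> /ltW].
Qed.

(** * Supports and closure properties of test functions *)

Lemma fsupp_sub f (A : set (R3 R)) : closed A ->
  (forall x, ~ A x -> f x = 0) -> fsupp f `<=` A.
Proof.
move=> cA f0; rewrite (iffLR (closure_id A) cA); apply: closure_subset => x /= fx.
by apply: contrapT => /f0 fx0; rewrite fx0 eqxx in fx.
Qed.

Lemma fsupp_partial i f : fsupp (partial i f) `<=` fsupp f.
Proof.
apply: fsupp_sub; first exact: closed_closure.
move=> x Nfx; rewrite /partial -(derive_cst (0 : R) x (basis3 i)).
apply: near_eq_derive.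
have : nbhs x (~` fsupp f).
  by apply: open_nbhs_nbhs; split => //; exact/closed_openC/closed_closure.
by apply: filterS => y /fsupp_out.
Qed.

Lemma test_partial i f : test f -> test (partial i f).
Proof.
move=> [sf cf]; split; first exact: smooth_partial.
apply: subclosed_compact cf _; [exact: closed_closure|exact: fsupp_partial].
Qed.

Lemma fsuppM f g : fsupp (fun x => f x * g x) `<=` fsupp g.
Proof.
apply: fsupp_sub; first exact: closed_closure.
by move=> x /fsupp_out ->; rewrite mulr0.
Qed.

Lemma testM f g : smooth f -> test g -> test (fun x => f x * g x).
Proof.
move=> sf [sg cg]; split; first exact: smoothM.
apply: subclosed_compact cg _; [exact: closed_closure|exact: fsuppM].
Qed.

Lemma testZ (a : R) g : test g -> test (fun x => a * g x).
Proof. by apply: testM; exact: smooth_cst. Qed.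

Lemma testD f g : test f -> test g -> test (fun x => f x + g x).
Proof.
move=> [sf cf] [sg cg]; split; first exact: smoothD.
apply: (subclosed_compact _ (compactU cf cg)); first exact: closed_closure.
apply: fsupp_sub; first by apply: closedU; exact: closed_closure.
by move=> x /not_orP[/fsupp_out -> /fsupp_out ->]; rewrite addr0.
Qed.

Lemma test_continuous f : test f -> continuous f.
Proof. by move=> [/smooth_continuous]. Qed.

Lemma integrable_test f : test f ->
  mu.-integrable setT (fun x : mR3 R => (f x)%:E).
Proof. by move=> [sf cf]; apply: integrable_continuous => //; exact: smooth_continuous. Qed.

(** Fubini's theorem with the [i]-th variable innermost reduces the claim to the fundamental theorem
    of calculus on lines parallel to the [i]-th axis. *)
Lemma integral_partial i f : test f -> (\int[mu]_x (partial i f x)%:E = 0)%E.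
Proof.
move=> tf; have [sf cf] := tf.
have tg := test_partial i tf; have [sg cg] := tg.
have [r Hr] := compact_sub_cube cf.
have f0 x : ~ cube r x -> f x = 0 by move=> H; apply: fsupp_out => /Hr.
have g0 x : ~ cube r x -> partial i f x = 0.
  by move=> H; apply: fsupp_out => /fsupp_partial/Hr.
have ig := integrable_test tg.
have cont := test_continuous tg.

have line y : proj3 i y = 0 ->
    (\int[leb]_t (partial i f (t *: basis3 i + y))%:E = 0)%E.
  move=> y0.
  (* [cube r] is closed; the margin 1 ensures that points outside the open interval really leave
     it. *)
  have out t : ~~ (- (r + 1) < t < r + 1) -> ~ cube r (t *: basis3 i + y).
    move=> tr /(_ i); rewrite proj3_line eqxx mul1r y0 addr0 ler_norml => /andP[? ?].
    by move/negP: tr; apply; apply/andP; split; lra.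
  apply: (@integral_derive0 (fun t => f (t *: basis3 i + y)) _ (r + 1)).
  - move=> t; apply: continuous_comp; last exact: cont.
    apply: cvgD; last exact: cvg_cst.
    exact: scalel_continuous.
  - by move=> t; apply/is_derive_line; exact: smooth_is_derive.
  - by move=> t /out/f0.
  - by move=> t /out/g0.
pose g : mR3 R -> \bar R := fun x => (partial i f x)%:E.
have ig' : (leb2 R \x leb)%E.-integrable setT g by [].
(* Fubini's theorem grants integrable slices for almost every [z] only; here each slice is bounded
   and supported in a square. *)
have section2 (z : R) : (leb2 R).-integrable setT
    (fun p : measurableTypeR R * measurableTypeR R => g (p, z)).
  have mQ : measurable (square r) by exact: measurableX.
  have -> : (fun p : measurableTypeR R * measurableTypeR R => g (p, z)) =
     ((EFin \o (fun p => partial i f (p, z))) \_ (square r)).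
    apply/funext => -[x y]; rewrite patchE; case: ifPn => //= /negP.
    rewrite inE/square/= !in_itv/= => H; rewrite /g g0// => /ord3P.
    by rewrite /proj3/= !ler_norml => -[H1 H2 _]; apply: H.
  apply: (iffLR (integrable_mkcond _ mQ)).
  apply: measurable_bounded_integrable => //.
  - exact: square_finite.
  - apply: measurable_funTS.
    by apply: (@measurable_fun_pair1 _ _ _ _ _ _ (partial i f)); exact: continuous_measurable3.
  - have [M M0 HM] := continuous_bounded cont cg.
    by exists M; split=> [|y My x _ /=]; [exact: num_real|exact: le_trans (HM _) (ltW My)].
suff H : [/\ i = i0 -> \int[mu]_x g x = 0,
    i = i1 -> \int[mu]_x g x = 0 & i = i2 -> \int[mu]_x g x = 0]%E.
  exact: (iffRL (ord3P (fun j => i = j -> \int[mu]_x g x = 0)%E) H i erefl).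
have E1 := @integral12_prod_meas1 _ _ _ _ R (leb2 R) leb g ig'.
have E2 := @integral21_prod_meas1 _ _ _ _ R (leb2 R) leb g ig'.
split=> ii.
- apply: (eq_trans (esym E2)); apply: integral0_eq => z _.
  apply: (eq_trans (esym (@integral21_prod_meas1 _ _ _ _ R leb leb _ (section2 z)))).
  apply: integral0_eq => y _; rewrite /fubini_G.
  have <- := line (0, y, z); last by rewrite ii.
  apply: eq_integral => t _; rewrite /g ii; congr (partial _ _ _)%:E.
  by apply: proj3_inj; apply/ord3P; rewrite !proj3_line /proj3/= !mul1r !mul0r addr0 !add0r.
- apply: (eq_trans (esym E2)); apply: integral0_eq => z _.
  apply: (eq_trans (esym (@integral12_prod_meas1 _ _ _ _ R leb leb _ (section2 z)))).
  apply: integral0_eq => x _; rewrite /fubini_F.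
  have <- := line (x, 0, z); last by rewrite ii.
  apply: eq_integral => t _; rewrite /g ii; congr (partial _ _ _)%:E.
  by apply: proj3_inj; apply/ord3P; rewrite !proj3_line /proj3/= !mul1r !mul0r addr0 !add0r.
- apply: (eq_trans (esym E1)); apply: integral0_eq => -[x y] _; rewrite /fubini_F.
  have <- := line (x, y, 0); last by rewrite ii.
  apply: eq_integral => t _; rewrite /g ii; congr (partial _ _ _)%:E.
  by apply: proj3_inj; apply/ord3P; rewrite !proj3_line /proj3/= !mul1r !mul0r addr0 !add0r.
Qed.

Lemma Rintegral_partial i f : test f -> \int[mu]_x partial i f x = 0.
Proof. by move=> tf; rewrite /Rintegral integral_partial. Qed.

Lemma integration_by_parts3 i f g : smooth f -> test g ->
  \int[mu]_x (f x * partial i g x) = - \int[mu]_x (partial i f x * g x).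
Proof.
move=> sf tg; have [sg cg] := tg.
have tfg := testM sf tg.
have := Rintegral_partial i tfg; rewrite partialM//.
have -> : (fun x => f x * partial i g x + g x * partial i f x) =
    (fun x => f x * partial i g x + partial i f x * g x).
  by apply/funext => x; rewrite (mulrC (g x)).
rewrite RintegralD//; last 2 first.
- exact: (integrable_test (testM sf (test_partial i tg))).
- exact: (integrable_test (testM (smooth_partial i sf) tg)).
by move/eqP; rewrite addr_eq0 => /eqP.
Qed.

(** The primitive from [-oo] vanishes to the left of the support, and to the right of it because it
    there equals the total integral of [w]. *)
Lemma primitive_compact (w : R -> R) r : smooth1 w ->
  (forall t, ~~ (- r < t < r) -> w t = 0) -> \int[leb]_t w t = 0 ->
  exists H : R -> R, [/\ smooth1 H, forall t, is_derive t (1 : R) H (w t) &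
    forall t, ~~ (- r < t < r) -> H t = 0].
Proof.
move=> sw w0 iw.
have cw := smooth1_continuous sw.
have intw := integrable_compact1 cw w0.
pose H (u : R) := \int[leb]_(t in `]-oo, u]) w t.
have dH t : is_derive t (1 : R) H (w t).
  have [||||dH H'] := @continuous_FTC1 R w -oo%O t (t + 1).
  - by rewrite ltrDl.
  - by apply: integrableS intw.
  - by rewrite ltNyr.
  - exact: cw.
  by split; [exact: dH|rewrite -derive1E; exact: H'].
exists H; split=> //; first exact: smooth1_primitive dH.
move=> t; rewrite negb_and -!leNgt => /orP[tr|rt].
  rewrite /H /Rintegral integral0_eq// => y /=; rewrite in_itv/= => yt.
  by rewrite w0// negb_and -!leNgt (le_trans yt).
rewrite -iw /H Rintegral_mkcond; apply: eq_Rintegral => y _.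
rewrite patchE; case: ifPn => // /negP; rewrite inE/= in_itv/= => /negP.
by rewrite -ltNge => ty; rewrite w0// negb_and -!leNgt (le_trans rt (ltW ty)) orbT.
Qed.

End integration_by_parts.

(** * The lemma of du Bois-Reymond *)

Section du_bois_reymond.
Context {R : realType}.
Local Notation leb := (@lebesgue_measure R).
Local Notation mu := (leb3 R).
Implicit Types (f g : R3 R -> R) (x : R3 R) (i j : 'I_3).

Definition boxes : set (set (R3 R)) := [set obox a b | a in setT & b in setT].

Lemma obox_setI a b c d : obox a b `&` obox c d =
  obox (fun i => Num.max (a i) (c i)) (fun i => Num.min (b i) (d i)) :> set (R3 R).
Proof.
apply/seteqP; split=> x.
  move=> [H1 H2] i; have /andP[h1 h2] := H1 i; have /andP[h3 h4] := H2 i.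
  by rewrite gt_max lt_min h1 h2 h3 h4.
move=> H; split=> i; have := H i; rewrite gt_max lt_min.
  by move=> /andP[/andP[-> _] /andP[->]].
by move=> /andP[/andP[_ ->] /andP[_ ->]].
Qed.

Lemma boxes_setI : setI_closed boxes.
Proof.
move=> _ _ [a _ [b _ <-]] [c _ [d _ <-]]; rewrite obox_setI.
by eexists => //; eexists.
Qed.

(** A slab in one coordinate is the union of boxes growing in the two others, so boxes make the
    coordinates measurable, hence also the identity. *)
Lemma measurable_boxes : @measurable _ (mR3 R) = <<s boxes>>.
Proof.
apply/seteqP; split; last first.
  apply: smallest_sub; first exact: sigma_algebra_measurable.
  by move=> _ [a _ [b _ <-]]; exact: measurable_obox.
have mproj i : measurable_fun setT (proj3 i : g_sigma_algebraType boxes -> R).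
  apply: (measurability _ (RGenOpens.measurableE R)).
  move=> _ [_ [c [d ->] <-]]; rewrite setTI.
  have -> : proj3 i @^-1` `]c, d[%classic = \bigcup_(n : nat)
      obox (fun j => if j == i then c else - n%:R) (fun j => if j == i then d else n%:R).
    apply/seteqP; split=> [x|x [n _ /(_ i)]]; last by rewrite eqxx /= in_itv.
    rewrite /= in_itv/= => xcd.
    have [r Hr] := compact_sub_cube (@compact_set1 _ x).
    exists (Num.truncn r).+1 => // j; have [->//|_] := eqVneq j i.
    by rewrite -ltr_norml (le_lt_trans _ (truncnS_gt r))//; exact: Hr.
  apply: bigcupT_measurable => n; apply: sub_sigma_algebra.
  by eexists => //; eexists.
have mid : measurable_fun (T := g_sigma_algebraType boxes) (U := mR3 R) setT id.
  have -> : (id : R3 R -> R3 R) = fun x => ((proj3 i0 x, proj3 i1 x), proj3 i2 x).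
    by apply/funext => -[[? ?] ?].
  exact: (measurable_fun_pair (measurable_fun_pair (mproj i0) (mproj i1)) (mproj i2)).
by move=> A mA; have := mid measurableT A mA; rewrite setTI.
Qed.

(** Dynkin's lemma: the sets whose trace on the box has integral 0 form a lambda-system, and boxes
    are a generating pi-system. *)
Lemma integral_boxes0 (G : R3 R -> R) (a b : 'I_3 -> R) :
  mu.-integrable (obox a b : set (mR3 R)) (EFin \o G) ->
  (forall c d, cbox c d `<=` cbox a b -> (\int[mu]_(x in obox c d) (G x)%:E = 0)%E) ->
  {ae mu, forall x, obox a b x -> G x = 0}.
Proof.
move=> iG G0.
have mQ : measurable (obox a b : set (mR3 R)) by exact: measurable_obox.
have key (A : set (mR3 R)) : measurable A ->
    (\int[mu]_(x in A `&` obox a b) (G x)%:E = 0)%E.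
  have mG (B : set (mR3 R)) : measurable B -> mu.-integrable (B `&` obox a b) (EFin \o G).
    by move=> mB; apply: integrableS iG => //; exact: measurableI.
  rewrite [measurable]measurable_boxes; move: A; apply: (@dynkin_induction _ (mR3 R) boxes
    (fun A => \int[mu]_(x in A `&` obox a b) (G x)%:E = 0)%E
    measurable_boxes boxes_setI) => /=.
  - by rewrite setTI; exact: G0.
  - move=> _ [c _ [d _ <-]].
    rewrite obox_setI; apply: G0 => x H i; have := H i.
    by rewrite ge_max le_min => /andP[/andP[_ ->] /andP[_ ->]].
  - move=> A mA IA.
    have : (\int[mu]_(x in (A `&` obox a b) `|` (~` A `&` obox a b)) (G x)%:E = 0)%E.
      by rewrite -setIUl setUv setTI; exact: G0.
    rewrite integral_setU_EFin//=.
    + by rewrite IA add0e.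
    + by apply: measurableI.
    + by apply: measurableI => //; exact: measurableC.
    + rewrite -setIUl setUv; case/integrableP: (mG _ measurableT) => /measurable_EFinP + _; exact.
    + by apply/disj_setPS => x [[? _] [? _]].
  - move=> F mF tF F0; rewrite setI_bigcupl integral_bigcup//.
    + by apply: eseries0 => n _ _; exact: F0.
    + exact: trivIset_setIr.
    + by move=> n; exact: measurableI.
    + by rewrite -setI_bigcupl; apply: mG; exact: bigcupT_measurable.
have := @integral_ae_eq _ _ _ mu _ mQ (cst 0%E) (EFin \o G) iG.
case=> [//|E EQ mE|N [mN N0 HN]].
  by rewrite integral0 -[RHS](key E mE) setIidl.
exists N; split=> // x /= H; apply: HN => /= K; apply: H => Qx.
by have [] := K Qx.
Qed.

(** * Tensor products and box bumps *)

Definition tensor (p : 'I_3 -> R -> R) x : R :=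
  p i0 (proj3 i0 x) * p i1 (proj3 i1 x) * p i2 (proj3 i2 x).

Lemma smooth_tensor p : (forall i, smooth1 (p i)) -> smooth (tensor p).
Proof.
move=> sp; apply: smoothM; [apply: smoothM|]; exact: smooth_proj3.
Qed.

Lemma tensor_out p a b x : (forall i t, ~~ (a i < t < b i) -> p i t = 0) ->
  ~ obox a b x -> tensor p x = 0.
Proof.
move=> p0 Nx; apply/eqP/negP => /negP tx; apply: Nx => i.
apply/negP => /negP /p0 pi0; move/negP: tx; apply; rewrite /tensor.
move: i pi0; apply/ord3P; split=> ->; rewrite ?mulr0 ?mul0r//.
Qed.

Lemma test_tensor p a b : (forall i, smooth1 (p i)) ->
  (forall i t, ~~ (a i < t < b i) -> p i t = 0) -> test (tensor p).
Proof.
move=> sp p0; split; first exact: smooth_tensor.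
apply: (subclosed_compact _ (@compact_cbox R a b)); first exact: closed_closure.
apply: fsupp_sub; first exact: closed_cbox.
move=> x Nx; apply: (tensor_out p0); exact: contra_not (@obox_sub_cbox _ _ _ _) Nx.
Qed.

Definition box_bump s (a b : 'I_3 -> R) := tensor (fun i => plateau s (a i) (b i)).

Lemma box_bump_out s a b x : 0 <= s -> ~ obox a b x -> box_bump s a b x = 0.
Proof. by move=> s0; apply: tensor_out => i t; exact: plateau_out. Qed.

Lemma test_box_bump s a b : 0 <= s -> test (box_bump s a b).
Proof.
move=> s0; apply: (@test_tensor _ a b) => [i|i t]; first exact: smooth1_plateau.
exact: plateau_out.
Qed.

Lemma box_bump_ge0 s a b x : 0 <= box_bump s a b x.
Proof. by apply: mulr_ge0; [apply: mulr_ge0|]; exact: plateau_ge0. Qed.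

Lemma box_bump_le1 s a b x : box_bump s a b x <= 1.
Proof.
have pg i t : 0 <= plateau s (a i) (b i) t by exact: plateau_ge0.
have pl i t : plateau s (a i) (b i) t <= 1 by exact: plateau_le1.
by apply: mulr_ile1 => //; [exact: mulr_ge0|exact: mulr_ile1].
Qed.

Lemma box_bump_in s a b x : 0 < s ->
  (forall i, a i + s^-1 <= proj3 i x <= b i - s^-1) -> box_bump s a b x = 1.
Proof. by move=> s0 H; rewrite /box_bump /tensor !plateau_in ?mulr1. Qed.

Lemma box_bump_near1 a b x : obox a b x -> exists2 s0, 0 < s0 &
  forall s, s0 <= s -> box_bump s a b x = 1.
Proof.
move=> abx.
have H i : exists2 s0, 0 < s0 & forall s, s0 <= s ->
    a i + s^-1 <= proj3 i x <= b i - s^-1.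
  have /andP[ax xb] := abx i.
  pose d := Num.min (proj3 i x - a i) (b i - proj3 i x).
  have d0 : 0 < d by rewrite lt_min !subr_gt0 ax.
  exists d^-1; rewrite ?invr_gt0// => s ds.
  have : s^-1 <= d.
    by rewrite -[leRHS]invrK lef_pV2// posrE ?invr_gt0// (lt_le_trans _ ds)// invr_gt0.
  by rewrite le_min => /andP[? ?]; apply/andP; split; lra.
have [s0 s00 Hs0] := H i0; have [s1 s10 Hs1] := H i1; have [s2 s20 Hs2] := H i2.
exists (Num.max s0 (Num.max s1 s2)) => [|s]; first by rewrite lt_max s00.
rewrite !ge_max => /and3P[h0 h1 h2]; apply: box_bump_in; first exact: lt_le_trans h0.
by apply/ord3P; split; [exact: Hs0|exact: Hs1|exact: Hs2].
Qed.

(** Dominated convergence along the steepnesses [n.+1] is run on the closed box, which is compact,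
    so that local integrability supplies the majorant [|G|]. *)
Lemma integral_obox_eq0 (G : R3 R -> R) a b : locally_integrable3 G ->
  (forall s, 0 < s -> \int[mu]_x (G x * box_bump s a b x) = 0) ->
  (\int[mu]_(x in obox a b) (G x)%:E = 0)%E.
Proof.
move=> lG G0.
have mK : measurable (cbox a b : set (mR3 R)).
  by apply: compact_measurable3; exact: compact_cbox.
have [mG iG] := lG.
pose f_ n : mR3 R -> \bar R := fun x => (G x * box_bump n.+1%:R a b x)%:E.
have if_ n : mu.-integrable setT (f_ n).
  have [sb cb] := @test_box_bump n.+1%:R a b (ler0n _ _).
  by apply: integrable_locM => //; exact: smooth_continuous.
have If_ n : (\int[mu]_(x in (cbox a b : set (mR3 R))) f_ n x = 0)%E.
  transitivity (\int[mu]_x f_ n x)%E.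
    rewrite integral_mkcond; apply: eq_integral => x _.
    rewrite patchE; case: ifPn => // /negP; rewrite inE => Nx.
    rewrite /f_ box_bump_out ?mulr0//.
    exact: contra_not (@obox_sub_cbox _ _ _ _) Nx.
  rewrite -[LHS]fineK; last exact: integrable_fin_num.
  by congr EFin; exact: (G0 n.+1%:R (ltr0Sn _ _)).
have [] := @dominated_convergence _ _ _ mu _ mK f_
  ((EFin \o G) \_ (obox a b : set (mR3 R))) (abse \o (EFin \o G)).
- by move=> n; apply: measurable_funTS; case/integrableP: (if_ n).
- apply/measurable_restrict => //; first exact: measurable_obox.
  by apply: measurable_funTS; exact/measurable_EFinP.
- apply: aeW => x _; rewrite patchE; case: ifPn => [|/negP]; rewrite inE => xab.
    have [s0 _ Hs0] := box_bump_near1 xab.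
    apply: cvg_near_cst; exists (Num.truncn s0) => //= n sn.
    rewrite /f_ Hs0 ?mulr1// ltW// (lt_le_trans (truncnS_gt s0))//.
    by rewrite ler_nat ltnS.
  rewrite [X in X @ _ --> _](_ : _ = cst 0%E); first exact: cvg_cst.
  by apply/funext => n; rewrite /f_ box_bump_out ?mulr0.
- by apply: integrable_abse; apply: iG; exact: compact_cbox.
- apply: aeW => x n _; rewrite /f_ /= lee_fin normrM ler_piMr//.
  by rewrite ger0_norm ?box_bump_ge0 ?box_bump_le1.
move=> _ _; rewrite (_ : [sequence _]_n = cst 0%E); last by apply/funext => n; rewrite /= If_.
move=> /(cvg_unique _ (cvg_cst 0%E)) => /(_ (@ereal_hausdorff R)) ->.
rewrite -integral_mkcondr setIidr//; exact: obox_sub_cbox.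
Qed.

(** Box bumps are the only test functions here because they are what the variational argument
    compares. The null sets of the countably many rational boxes inside [Om] are collected through
    [unpickle]. *)
Lemma du_bois_reymond (Om : set (R3 R)) (G : R3 R -> R) : open Om ->
  locally_integrable3 G ->
  (forall s a b, 0 < s -> cbox a b `<=` Om ->
    \int[mu]_x (G x * box_bump s a b x) = 0) ->
  {ae mu, forall x, Om x -> G x = 0}.
Proof.
move=> oOm lG G0.
pose B (q : {ffun 'I_3 -> rat * rat}) : ('I_3 -> R) * ('I_3 -> R) :=
  (fun i => ratr (q i).1, fun i => ratr (q i).2).
have H (q : {ffun 'I_3 -> rat * rat}) : cbox (B q).1 (B q).2 `<=` Om ->
    {ae mu, forall x, obox (B q).1 (B q).2 x -> G x = 0}.
  move=> BO; apply: integral_boxes0.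
    apply: (@integrableS _ _ _ _ (cbox (B q).1 (B q).2 : set (mR3 R))).
    - by apply: compact_measurable3; exact: compact_cbox.
    - exact: measurable_obox.
    - exact: obox_sub_cbox.
    - by apply: lG.2; exact: compact_cbox.
  move=> c d cd; apply: integral_obox_eq0 => // s s0; apply: G0 => //.
  exact: subset_trans BO.
pose P n x := match @unpickle {ffun 'I_3 -> rat * rat} n with
  | Some q => cbox (B q).1 (B q).2 `<=` Om -> obox (B q).1 (B q).2 x -> G x = 0
  | None => True end.
have : {ae mu, forall x, forall n, P n x}.
  apply: ae_foralln => n; rewrite /P; case: unpickle => [q|]; last exact: aeW.
  have [/H|Nq] := pselect (cbox (B q).1 (B q).2 `<=` Om); last exact: aeW.
  by apply: (@filterS _ _ (ae_filter_ringOfSetsType mu)) => x Hx _.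
apply: (@filterS _ _ (ae_filter_ringOfSetsType mu)) => x Hx Omx.
have [q qx qO] := open_rat_cbox oOm Omx.
by have := Hx (pickle q); rewrite /P pickleK => /(_ qO qx).
Qed.

End du_bois_reymond.

(** * The Dirichlet class *)

Section dirichlet_theory.
Context {R : realType}.
Local Notation mu := (leb3 R).
Implicit Types (f g : R3 R -> R) (x : R3 R) (i j : 'I_3).

Definition square_integrable (D : set (R3 R)) f :=
  measurable_fun [set: mR3 R] (f : mR3 R -> R) /\
  (\int[mu]_(x in (D : set (mR3 R))) (f x ^+ 2)%:E < +oo)%E.

Lemma square_integrableP (D : set (mR3 R)) f : measurable D ->
  square_integrable D f -> mu.-integrable D (fun x => (f x ^+ 2)%:E).
Proof.
move=> mD [mf foo]; apply/integrableP; split.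
  by apply/measurable_EFinP; apply: measurable_funTS; exact: measurable_funX.
rewrite (eq_integral (fun x : mR3 R => (f x ^+ 2)%:E))// => x _.
by rewrite gee0_abs// lee_fin sqr_ge0.
Qed.

Lemma square_integrableB (D : set (mR3 R)) f g : measurable D ->
  square_integrable D f -> square_integrable D g ->
  square_integrable D (fun x => f x - g x).
Proof.
move=> mD sf sg; have [mf _] := sf; have [mg _] := sg.
have mfg : measurable_fun [set: mR3 R] (fun x : mR3 R => f x - g x).
  exact: measurable_funB.
split=> //.
have H : mu.-integrable D (fun x => (2 * f x ^+ 2 + 2 * g x ^+ 2)%:E).
  under eq_fun do rewrite EFinD !EFinM.
  by apply: integrableD => //; apply: integrableZl => //; exact: square_integrableP.
case/integrableP: H => _; apply: le_lt_trans; apply: ge0_le_integral => //.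
- by move=> x _; rewrite lee_fin sqr_ge0.
- by apply/measurable_EFinP; apply: measurable_funTS; exact: measurable_funX.
- apply/measurable_EFinP; apply: measurable_funTS; apply: measurableT_comp => //.
  by apply: measurable_funD; apply: measurable_funM => //; exact: measurable_funX.
- move=> x _; rewrite /= lee_fin ger0_norm; last by rewrite addr_ge0// mulr_ge0// sqr_ge0.
  have := sqr_ge0 (f x + g x); rewrite sqrrD sqrrB; lra.
Qed.

Lemma square_integrable_locally f :
  (forall K, compact K -> square_integrable K f) -> locally_integrable3 f.
Proof.
move=> sf; have [mf _] := sf set0 compact0.
split=> // K cK; have mK := compact_measurable3 cK.
have H : mu.-integrable (K : set (mR3 R)) (fun x => (1 + f x ^+ 2)%:E).
  under eq_fun do rewrite EFinD.
  apply: integrableD => //; last by apply: square_integrableP => //; exact: sf.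
  have [_] := @locally_integrable_continuous R (fun=> 1) (fun x => cvg_cst _).
  exact.
apply: le_integrable H => //.
  by apply/measurable_EFinP; exact: measurable_funTS.
move=> x _; rewrite /= lee_fin [leRHS]ger0_norm; last by rewrite addr_ge0// sqr_ge0.
have := sqr_ge0 (`|f x| - 1); rewrite sqrrB real_normK ?num_real//; have := normr_ge0 (f x); lra.
Qed.

Lemma square_integrable_sub (D K : set (mR3 R)) f : measurable D -> measurable K ->
  K `<=` D -> square_integrable D f -> square_integrable K f.
Proof.
move=> mD mK KD [mf foo]; split=> //; apply: le_lt_trans foo.
apply: ge0_subset_integral => //.
  by apply/measurable_EFinP; apply: measurable_funTS; exact: measurable_funX.
by move=> x _; rewrite lee_fin sqr_ge0.
Qed.

Lemma square_integrable_test f : test f -> square_integrable setT f.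
Proof.
move=> tf; split; first by apply: continuous_measurable3; exact: test_continuous.
have /integrableP[_] := integrable_test (testM tf.1 tf).
rewrite (eq_integral (fun x : mR3 R => (f x ^+ 2)%:E))// => x _.
by rewrite gee0_abs// lee_fin -expr2 sqr_ge0.
Qed.

Lemma locally_integrable3B f g : locally_integrable3 f -> locally_integrable3 g ->
  locally_integrable3 (fun x => f x - g x).
Proof.
move=> [mf lf] [mg lg]; split; first exact: measurable_funB.
move=> K cK; have mK := compact_measurable3 cK.
have -> : EFin \o (fun x => f x - g x) = ((EFin \o f) \- (EFin \o g))%E.
  by apply/funext => x; rewrite /= EFinB.
exact: (integrableB mK (lf K cK) (lg K cK)).
Qed.

Lemma locally_integrable_L2 f : square_integrable setT f -> locally_integrable3 f.
Proof.
move=> sf; apply: square_integrable_locally => K cK.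
by apply: square_integrable_sub sf => //; exact: compact_measurable3.
Qed.

Lemma integrable_loc_test f g : locally_integrable3 f -> test g ->
  mu.-integrable setT (EFin \o (fun x : mR3 R => f x * g x)).
Proof. by move=> lf [sg cg]; apply: integrable_locM => //; exact: smooth_continuous. Qed.

(** [grad f] is an arbitrary choice among weak gradients; this is what allows a computed gradient to
    replace it under an integral. *)
Lemma weak_gradient_unique f G H : weak_gradient f G -> weak_gradient f H ->
  forall i, {ae mu, forall x, G i x = H i x}.
Proof.
move=> wG wH i; have [mG oG EG] := wG i; have [mH oH EH] := wH i.
have lG : locally_integrable3 (G i) by exact: locally_integrable_L2.
have lH : locally_integrable3 (H i) by exact: locally_integrable_L2.
have := @du_bois_reymond R setT (fun x => G i x - H i x) openT (locally_integrable3B lG lH).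
case=> [s a b s0 _|N [mN N0 NH]].
  have tb := test_box_bump a b (ltW s0).
  under eq_Rintegral do rewrite mulrBl.
  rewrite RintegralB//; try exact: integrable_loc_test.
  by apply/eqP; rewrite subr_eq0 -eqr_opp -EG// EH.
exists N; split=> // x /= K; apply: NH => /= /(_ I) /eqP; rewrite subr_eq0 => /eqP.
exact: K.
Qed.

Lemma weak_gradient_test f : test f -> weak_gradient f (fun i => partial i f).
Proof.
move=> tf i; have [? ?] := square_integrable_test (test_partial i tf).
by split=> // phi tphi; rewrite integration_by_parts3//; case: tf.
Qed.

(** The difference is written [-1 * phi x + f x] to be literally the instance [a = -1] of
    [linear_on]. *)
Lemma weak_gradientB f phi G : locally_integrable3 f -> weak_gradient f G ->
  test phi ->
  weak_gradient (fun x => -1 * phi x + f x) (fun i x => G i x - partial i phi x).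
Proof.
move=> lf wG tphi i; have [mG oG EG] := wG i.
have lG : locally_integrable3 (G i) by exact: locally_integrable_L2.
have [m1 o1] := square_integrableB measurableT (conj mG oG) (square_integrable_test (test_partial i tphi)).
split=> // psi tpsi.
have lphi : locally_integrable3 phi.
  by apply: locally_integrable_continuous; exact: test_continuous.
have ldphi : locally_integrable3 (partial i phi).
  by apply: locally_integrable_continuous; apply: test_continuous; exact: test_partial.
have dpsi := test_partial i tpsi.
transitivity (\int[mu]_x (f x * partial i psi x - phi x * partial i psi x)).
  by apply: eq_Rintegral => x _; ring.
rewrite RintegralB//; try exact: integrable_loc_test.
rewrite EG// integration_by_parts3//; last by case: tphi.
under [in RHS]eq_Rintegral do rewrite mulrBl.
rewrite [in RHS]RintegralB//; try exact: integrable_loc_test.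
by ring.
Qed.

Lemma gradP f : dirichlet f -> weak_gradient f (grad f).
Proof. by move=> [_ [G wG] _]; exact: (xgetPex _ (ex_intro _ G wG)). Qed.

Lemma dirichlet_locally_integrable f : dirichlet f -> locally_integrable3 f.
Proof.
move=> [mf _ [phi [tphi _ Hphi]]]; apply: square_integrable_locally => K cK.
have mK := compact_measurable3 cK.
(* Convergence to 0 in the extended reals makes the integrals finite from some rank on; [f] is then
   recovered as [phi N - (phi N - f)]. *)
have [N _ /(_ N (leqnn N)) HN] := cvg_is_fine (Hphi K cK).
have mphi := continuous_measurable3 (test_continuous (tphi N)).
have sphi : square_integrable K (phi N).
  by apply: square_integrable_sub (square_integrable_test (tphi N)).
have := @square_integrableB K (phi N) (fun x => phi N x - f x) mK sphi.
have -> : (fun x => phi N x - (phi N x - f x)) = f by apply/funext => x; ring.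
apply; split; first exact: measurable_funB.
by move: HN; rewrite fin_numE => /andP[_]; rewrite -ltey.
Qed.

Lemma grad_square_integrable f i : dirichlet f -> square_integrable setT (grad f i).
Proof. by move=> /gradP/(_ i)[]. Qed.

Lemma sum_sqr_ge0 (A : 'I_3 -> R3 R -> R) x : 0 <= \sum_(i < 3) A i x ^+ 2.
Proof. by apply: sumr_ge0 => i _; exact: sqr_ge0. Qed.

Lemma measurable_sum_sqr (A : 'I_3 -> R3 R -> R) :
  (forall i, measurable_fun [set: mR3 R] (A i : mR3 R -> R)) ->
  measurable_fun [set: mR3 R] (fun x : mR3 R => (\sum_(i < 3) A i x ^+ 2)%:E).
Proof.
move=> mA; apply/measurable_EFinP; apply: measurable_sum => i.
exact: measurable_funX.
Qed.

Lemma ae_eq_sum_sqr (A B : 'I_3 -> R3 R -> R) :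
  (forall i, measurable_fun [set: mR3 R] (A i : mR3 R -> R)) ->
  (forall i, measurable_fun [set: mR3 R] (B i : mR3 R -> R)) ->
  (forall i, {ae mu, forall x, A i x = B i x}) ->
  (\int[mu]_x (\sum_(i < 3) A i x ^+ 2)%:E =
   \int[mu]_x (\sum_(i < 3) B i x ^+ 2)%:E)%E.
Proof.
move=> mA mB AB; apply: ge0_ae_eq_integral => //.
- exact: measurable_sum_sqr.
- exact: measurable_sum_sqr.
- by move=> x _; rewrite lee_fin sum_sqr_ge0.
- by move=> x _; rewrite lee_fin sum_sqr_ge0.
have H : {ae mu, forall x, [/\ A i0 x = B i0 x, A i1 x = B i1 x & A i2 x = B i2 x]}.
  apply: (@filterS3 _ _ (ae_filter_ringOfSetsType mu) _ _ _ _ _ (AB i0) (AB i1) (AB i2)).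
  by move=> x.
apply: (@filterS _ _ (ae_filter_ringOfSetsType mu)) H => x.
by move=> /(@ord3P (fun i => A i x = B i x)) H _; congr EFin; apply: eq_bigr => i _; rewrite H.
Qed.

Lemma dirichlet_approx f phi : dirichlet f -> test phi ->
  dirichlet (fun x => -1 * phi x + f x) /\
  dirichlet_energy (fun x => -1 * phi x + f x) =
    (\int[mu]_x (\sum_(i < 3) (partial i phi x - grad f i x) ^+ 2)%:E)%E.
Proof.
move=> df tphi; have [mf _ [psi [tpsi psi1 psi2]]] := df.
have lf := dirichlet_locally_integrable df.
have wB := weak_gradientB lf (gradP df) tphi.
set h := fun x => _ + _.
have wh : weak_gradient h (grad h) by exact: (xgetPex _ (ex_intro _ _ wB)).
have mphi := continuous_measurable3 (test_continuous tphi).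
have mdphi i : measurable_fun [set: mR3 R] (partial i phi : mR3 R -> R).
  exact: continuous_measurable3 (test_continuous (test_partial i tphi)).
have mgf i : measurable_fun [set: mR3 R] (grad f i : mR3 R -> R).
  by have [] := gradP df i.
have mgh i : measurable_fun [set: mR3 R] (grad h i : mR3 R -> R).
  by have [] := wh i.
(* Used with [g = 0] for the energy, and with [g] the gradient of [-1 * phi + psi n] for the
   approximating sequence. *)
have E (g : 'I_3 -> R3 R -> R) :
  (forall i, measurable_fun [set: mR3 R] (g i : mR3 R -> R)) ->
  (\int[mu]_x (\sum_(i < 3) (g i x - grad h i x) ^+ 2)%:E =
  \int[mu]_x (\sum_(i < 3) (g i x + partial i phi x - grad f i x) ^+ 2)%:E)%E.
  move=> mg; apply: ae_eq_sum_sqr => i.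
  - exact: measurable_funB.
  - by apply: measurable_funB => //; exact: measurable_funD.
  apply: (@filterS _ _ (ae_filter_ringOfSetsType mu)) (weak_gradient_unique wh wB i) => x -> /=.
  by ring.
split; last first.
  have := E (fun _ _ => 0) (fun=> measurable_cst _).
  rewrite /dirichlet_energy => H.
  transitivity (\int[mu]_x (\sum_(i < 3) (0 - grad h i x) ^+ 2)%:E)%E.
    by apply: eq_integral => x _; congr EFin; apply: eq_bigr => i _; rewrite sub0r sqrrN.
  rewrite H; apply: eq_integral => x _; congr EFin; apply: eq_bigr => i _.
  by rewrite add0r.
split; first by apply: measurable_funD => //; exact: measurable_funM.
  by exists (grad h).
exists (fun n x => -1 * phi x + psi n x); split.
- by move=> n; exact: (testD (testZ (-1) tphi) (tpsi n)).
- have : (\int[mu]_x (\sum_(i < 3) (partial i (psi n) x - grad f i x) ^+ 2)%:E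
             @[n --> \oo] --> 0)%E by [].
  apply: cvg_trans; apply: near_eq_cvg; apply: nearW => n.
  have [sphi _] := tphi; have [sp _] := tpsi n.
  rewrite E => [|i]; last first.
    apply: continuous_measurable3; apply: test_continuous; apply: test_partial.
    exact: (testD (testZ (-1) tphi) (tpsi n)).
  apply: eq_integral => x _; congr EFin; apply: eq_bigr => i _.
  rewrite (partialD i (smoothZ (-1) sphi) sp) (partialZ (-1) i sphi).
  by congr (_ ^+ 2); ring.
- move=> K cK; have := psi2 K cK.
  apply: cvg_trans; apply: near_eq_cvg; apply: nearW => n.
  by apply: eq_integral => x _; congr EFin; rewrite /h; congr (_ ^+ 2); ring.
Qed.

Lemma dirichlet_test (phi : R3 R -> R) : test phi -> dirichlet phi.
Proof.
move=> tphi; have wphi := weak_gradient_test tphi.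
have wg : weak_gradient phi (grad phi) by exact: (xgetPex _ (ex_intro _ _ wphi)).
split; first exact: continuous_measurable3 (test_continuous tphi).
  by exists (grad phi).
exists (fun=> phi); split=> //.
- rewrite (_ : (\int[mu]_x _)%E = 0%E); first exact: cvg_cst.
  have mp i : measurable_fun [set: mR3 R] (partial i phi : mR3 R -> R).
    by have [] := wphi i.
  have mg i : measurable_fun [set: mR3 R] (grad phi i : mR3 R -> R).
    by have [] := wg i.
  rewrite (@ae_eq_sum_sqr _ (fun _ _ => 0)).
  + by apply: integral0_eq => x _; rewrite big1// => i _; rewrite expr0n.
  + by move=> i; exact: measurable_funB.
  + by move=> i; exact: measurable_cst.
  + move=> i; apply: (@filterS _ _ (ae_filter_ringOfSetsType mu)) (weak_gradient_unique wg wphi i) => x ->.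
    by rewrite subrr.
- move=> K cK; rewrite integral0_eq; first exact: cvg_cst.
  by move=> x _; rewrite subrr expr0n.
Qed.

Lemma dirichlet_density f (e : R) : dirichlet f -> 0 < e -> exists phi,
  [/\ test phi, dirichlet (fun x => -1 * phi x + f x) &
      dirichlet_norm (fun x => -1 * phi x + f x) < e].
Proof.
move=> df e0; have [_ _ [psi [tpsi psi1 _]]] := df.
have /cvgr_lt : fine (\int[mu]_x (\sum_(i < 3) (partial i (psi n) x - grad f i x) ^+ 2)%:E)%E
   @[n --> \oo] --> (0 : R) by exact: fine_cvg.
move=> /(_ (e ^+ 2)); rewrite exprn_gt0// => /(_ isT)[N _ /(_ N (leqnn N)) /= HN].
have [dB EB] := dirichlet_approx df (tpsi N).
exists (psi N); split=> //; rewrite /dirichlet_norm EB.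
have : Num.sqrt (e ^+ 2) = e by rewrite sqrtr_sqr gtr0_norm.
by move=> <-; rewrite ltr_sqrt// exprn_gt0.
Qed.

(** Both extensions agree on a test function close to [f], so their difference at [f] is their
    difference at a function of small Dirichlet norm. *)
Lemma extension_unique (l L1 L2 : @functional R) (f : R3 R -> R) : continuous_extension l L1 ->
  continuous_extension l L2 -> dirichlet f -> L1 f = L2 f.
Proof.
move=> [T1 N1 [M1 B1]] [T2 N2 [M2 B2]] df.
apply/eqP; rewrite -subr_eq0 -normr_le0; apply/ler_addgt0Pl => e e0; rewrite addr0.
(* [M1] and [M2] come without a sign, hence the absolute values; the 1 makes [M] positive, so that
   [e / M] is a legitimate radius. *)
pose M := `|M1| + `|M2| + 1.
have M0 : 0 < M by rewrite ltr_wpDl// addr_ge0.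
have [phi [tphi dB nB]] := dirichlet_density df (divr_gt0 e0 M0).
have dphi := dirichlet_test tphi.
have E : L1 f - L2 f = L1 (fun x => -1 * phi x + f x) - L2 (fun x => -1 * phi x + f x).
  by rewrite (N1 (-1) _ _ dphi df) (N2 (-1) _ _ dphi df) (T1 _ tphi) (T2 _ tphi); ring.
rewrite E (le_trans (ler_normB _ _))//.
apply: (le_trans (lerD (B1 _ dB) (B2 _ dB))).
move: nB; rewrite ltr_pdivlMr// => /ltW; apply: le_trans.
rewrite -mulrDl mulrC ler_wpM2l ?sqrtr_ge0//.
have := ler_norm M1; have := ler_norm M2; rewrite /M; lra.
Qed.

End dirichlet_theory.

(** * Functionals given by a density *)

Section density_functionals.
Context {R : realType}.
Local Notation mu := (leb3 R).
Implicit Types (f g w : R3 R -> R) (x : R3 R) (i j : 'I_3).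

Lemma integrable_sum_sqr_grad f : dirichlet f ->
  mu.-integrable setT (EFin \o (fun x : mR3 R => \sum_(i < 3) grad f i x ^+ 2)).
Proof.
move=> df.
have H i : mu.-integrable setT (fun x : mR3 R => (grad f i x ^+ 2)%:E).
  by apply: square_integrableP => //; exact: grad_square_integrable.
rewrite (_ : _ \o _ = fun x : mR3 R => (\sum_(i < 3) (grad f i x ^+ 2)%:E)%E).
  by apply: integrable_sum => // i _; exact: H.
by apply/funext => x /=; rewrite sumEFin.
Qed.

Lemma Rintegral_grad_sqr_le f i : dirichlet f ->
  \int[mu]_x (grad f i x ^+ 2) <= dirichlet_norm f ^+ 2.
Proof.
move=> df; have -> : dirichlet_norm f ^+ 2 = \int[mu]_x (\sum_(i < 3) grad f i x ^+ 2).
  rewrite sqr_sqrtr//; apply: fine_ge0; apply: integral_ge0 => x _.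
  by rewrite lee_fin sum_sqr_ge0.
apply: le_Rintegral => //.
- by apply: square_integrableP => //; exact: grad_square_integrable.
- exact: integrable_sum_sqr_grad.
- move=> x _; rewrite (bigD1 i)//= lerDl; apply: sumr_ge0 => j _; exact: sqr_ge0.
Qed.

(* AM-GM with a free weight t, to be optimised, stands in for Cauchy-Schwarz. *)
Lemma grad_pairing_bound f chi i : dirichlet f -> test chi ->
  `|\int[mu]_x (grad f i x * chi x)| <=
    (1 + \int[mu]_x (chi x ^+ 2)) / 2 * dirichlet_norm f.
Proof.
move=> df tchi; set B := \int[mu]_x (chi x ^+ 2); set s := dirichlet_norm f.
have sg := grad_square_integrable i df.
have schi := square_integrable_test tchi.
have ig := square_integrableP measurableT sg.
have ic := square_integrableP measurableT schi.
have lg := locally_integrable_L2 sg.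
have B0 : 0 <= B by apply: Rintegral_ge0 => x _; exact: sqr_ge0.
have s0 : 0 <= s by exact: sqrtr_ge0.
have As := Rintegral_grad_sqr_le i df.
have key t : 0 < t -> `|\int[mu]_x (grad f i x * chi x)| <= (t * s ^+ 2 + t^-1 * B) / 2.
  move=> t0; have ti0 : 0 < t^-1 by rewrite invr_gt0.
  have igc := integrable_loc_test lg tchi.
  have i1 : mu.-integrable setT (EFin \o (fun x : mR3 R => t / 2 * grad f i x ^+ 2)).
    by apply: eq_integrable (integrableZl measurableT (t / 2) ig).
  have i2 : mu.-integrable setT (EFin \o (fun x : mR3 R => t^-1 / 2 * chi x ^+ 2)).
    by apply: eq_integrable (integrableZl measurableT (t^-1 / 2) ic).
  apply: (le_trans (le_normr_Rintegral measurableT igc)).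
  apply: (@le_trans _ _ (\int[mu]_x (t / 2 * grad f i x ^+ 2 + t^-1 / 2 * chi x ^+ 2))).
    apply: le_Rintegral => //.
    - exact: integrable_norm.
    - by apply: eq_integrable (integrableD measurableT i1 i2).
    - move=> x _; rewrite normrM.
      rewrite -(real_normK (num_real (grad f i x))) -(real_normK (num_real (chi x))).
      set u := `|_|; set v := `|_|.
      have := mulr_ge0 (ltW ti0) (sqr_ge0 (t * u - v)).
      have -> : t^-1 * (t * u - v) ^+ 2 = t * u ^+ 2 - 2 * (u * v) + t^-1 * v ^+ 2.
        by field; rewrite gt_eqF.
      lra.
  rewrite RintegralD// RintegralZl// RintegralZl//.
  have : t / 2 * \int[mu]_x grad f i x ^+ 2 <= t / 2 * s ^+ 2.
    by apply: ler_wpM2l => //; rewrite divr_ge0// ltW.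
  rewrite -/B; lra.
move: s0; rewrite le_eqVlt => /predU1P[s0|s0].
  rewrite -s0 mulr0; apply/ler_addgt0Pl => e e0; rewrite addr0.
  have eB : 0 < (B + 1) / e by rewrite divr_gt0// ltr_wpDl.
  apply: (le_trans (key _ eB)); rewrite -s0 expr0n mulr0 add0r invf_div.
  have : e / (B + 1) * B <= e.
    by rewrite mulrAC ler_pdivrMr ?ltr_wpDl// ler_pM2l// lerDl.
  by move: e0; lra.
apply: (le_trans (key s^-1 _)); first by rewrite invr_gt0.
by rewrite invrK expr2 mulKf ?gt_eqF//; lra.
Qed.

Definition density_functional w : @functional R := fun f => \int[mu]_x (f x * w x).

Lemma density_functional_linear w a f g : test w ->
  locally_integrable3 f -> locally_integrable3 g ->
  density_functional w (fun x => a * f x + g x) =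
  a * density_functional w f + density_functional w g.
Proof.
move=> tw lf lg; have iF := integrable_loc_test lf tw.
have iG := integrable_loc_test lg tw.
have iaF : mu.-integrable setT (EFin \o (fun x : mR3 R => a * (f x * w x))).
  by apply: eq_integrable (integrableZl measurableT a iF).
rewrite /density_functional.
under eq_Rintegral do rewrite mulrDl -mulrA.
by rewrite RintegralD// RintegralZl.
Qed.

Lemma test_locally_integrable f : test f -> locally_integrable3 f.
Proof. by move=> tf; apply: locally_integrable_continuous; exact: test_continuous. Qed.

Lemma density_functional_distribution w : test w ->
  Defs.distribution (density_functional w).
Proof.
move=> tw; split=> [a f g tf tg|phi f tphi tf [_ /(_ [::]) Hphi]].
  by apply: density_functional_linear => //; exact: test_locally_integrable.
apply/cvgrPdist_le => e e0.
pose M := \int[mu]_x `|w x| + 1.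
have iw := integrable_norm (integrable_test tw).
have M0 : 0 < M by rewrite ltr_wpDl//; apply: Rintegral_ge0.
have d0 : 0 < e / M by rewrite divr_gt0.
have : \forall n \near \oo, forall x, `|f x - phi n x| < e / M.
  apply: (Hphi [set h | forall x, `|f x - h x| < e / M]).
  apply/uniform_nbhs; exists [set xy : R * R | ball xy.1 (e / M) xy.2]; split.
    exact: (entourage_ball _ (PosNum d0)).
  by move=> h /= H x; exact: H.
apply: filterS => n Hn.
have lf := test_locally_integrable tf; have lphi := test_locally_integrable (tphi n).
have -> : density_functional w f - density_functional w (phi n) =
    \int[mu]_x ((f x - phi n x) * w x).
  under eq_Rintegral do rewrite mulrBl.
  by rewrite RintegralB//; exact: integrable_loc_test.
have iD := integrable_loc_test (locally_integrable3B lf lphi) tw.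
apply: (le_trans (le_normr_Rintegral measurableT iD)).
apply: (@le_trans _ _ (\int[mu]_x (e / M * `|w x|))).
  apply: le_Rintegral => //.
  - exact: integrable_norm.
  - by apply: eq_integrable (integrableZl measurableT (e / M) iw).
  - by move=> x _; rewrite normrM ler_wpM2r// ltW.
rewrite RintegralZl// mulrAC ler_pdivrMr//.
by rewrite ler_pM2l// /M lerDl.
Qed.

Definition divergence (chi : 'I_3 -> R3 R -> R) x : R :=
  partial i0 (chi i0) x + partial i1 (chi i1) x + partial i2 (chi i2) x.

Lemma test_divergence chi : (forall i, test (chi i)) -> test (divergence chi).
Proof. by move=> tc; apply: testD; [apply: testD|]; exact: test_partial. Qed.

Lemma divergence_pairing chi f : (forall i, test (chi i)) -> dirichlet f ->
  density_functional (divergence chi) f =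
  - (\int[mu]_x (grad f i0 x * chi i0 x) + \int[mu]_x (grad f i1 x * chi i1 x) +
     \int[mu]_x (grad f i2 x * chi i2 x)).
Proof.
move=> tc df; have lf := dirichlet_locally_integrable df.
have E i : \int[mu]_x (f x * partial i (chi i) x) = - \int[mu]_x (grad f i x * chi i x).
  by have [_ _] := gradP df i; exact.
have I i := integrable_loc_test lf (test_partial i (tc i)).
rewrite /density_functional /divergence.
have ID : mu.-integrable setT (EFin \o (fun x : mR3 R =>
    f x * partial i0 (chi i0) x + f x * partial i1 (chi i1) x)).
  by apply: eq_integrable (integrableD measurableT (I i0) (I i1)).
under eq_Rintegral do rewrite !mulrDr.
by rewrite RintegralD// RintegralD// !E; ring.
Qed.

(** The same integral makes sense on test functions and on the Dirichlet class, so the functional is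
    its own continuous extension. *)
Lemma divergence_dual chi : (forall i, test (chi i)) ->
  dirichlet_dual (density_functional (divergence chi)) /\
  continuous_extension (density_functional (divergence chi))
    (density_functional (divergence chi)).
Proof.
move=> tc; have tw := test_divergence tc.
have C : continuous_extension (density_functional (divergence chi))
    (density_functional (divergence chi)).
  split=> // [a f g df dg|].
    by apply: density_functional_linear => //; exact: dirichlet_locally_integrable.
  pose M i := (1 + \int[mu]_x (chi i x ^+ 2)) / 2.
  exists (M i0 + M i1 + M i2) => f df.
  rewrite divergence_pairing// normrN (le_trans (ler_normD _ _))// mulrDl lerD//.
    by rewrite (le_trans (ler_normD _ _))// mulrDl lerD//; exact: grad_pairing_bound.
  exact: grad_pairing_bound.
split=> //; split; first exact: density_functional_distribution.
by eexists; exact: C.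
Qed.

Lemma extensionP (l L : @functional R) f : continuous_extension l L -> dirichlet f ->
  extension l f = L f.
Proof.
move=> lL; apply: (extension_unique (l := l)) => //.
exact: (xgetPex _ (ex_intro _ L lL)).
Qed.

End density_functionals.

(** * Supports and cutoffs *)

Section supports.
Context {R : realType}.
Local Notation mu := (leb3 R).
Implicit Types (f g : R3 R -> R) (x : R3 R) (i j : 'I_3).

Lemma local_bump x (U : set (R3 R)) : nbhs x U ->
  exists b (V : set (R3 R)), [/\ test b, fsupp b `<=` U, open V, V x &
    forall y, V y -> b y = 1].
Proof.
move=> /nbhs_obox[d d0 dU].
(* Half-side [d / 2] keeps the closed support within distance [d] of [x]; steepness [4 / d] gives
   flanks of width [d / 4], so the bump is 1 on the box of half-side [d / 4]. *)
pose a i := proj3 i x - d / 2; pose c i := proj3 i x + d / 2.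
exists (box_bump (4 / d) a c).
exists (obox (fun i => proj3 i x - d / 4) (fun i => proj3 i x + d / 4)).
have s0 : 0 < 4 / d by rewrite divr_gt0.
split.
- by apply: test_box_bump; exact: ltW.
- apply: (@subset_trans _ (cbox a c)).
    apply: fsupp_sub; first exact: closed_cbox.
    move=> y Ny; apply: box_bump_out; first exact: ltW.
    by apply: contra_not Ny; exact: obox_sub_cbox.
  move=> y Hy; apply: dU => i; have := Hy i; rewrite /a /c => /andP[? ?].
  by rewrite distrC ltr_distl; apply/andP; split; lra.
- exact: open_obox.
- by move=> i; apply/andP; split; rewrite ?ltrBlDr ltrDl divr_gt0.
- move=> y Hy; apply: box_bump_in => // i; rewrite invf_div.
  by have := Hy i; rewrite /a /c => /andP[? ?]; apply/andP; split; lra.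
Qed.

(* [1 - glue b r y] is the product of the [1 - b x y] for [x] in [r]. *)
Fixpoint glue (b : R3 R -> R3 R -> R) (r : seq (R3 R)) y : R :=
  if r is x :: r' then b x y + (1 - b x y) * glue b r' y else 0.

Lemma glue1 b r x y : x \in r -> b x y = 1 -> glue b r y = 1.
Proof.
elim: r => // z r IH; rewrite inE => /predU1P[<-|xr] bxy /=.
  by rewrite bxy subrr mul0r addr0.
by rewrite (IH xr bxy); ring.
Qed.

Lemma smooth_onem f : smooth f -> smooth (fun y => 1 - f y).
Proof.
move=> sf; have := smoothD (smooth_cst 1) (smoothZ (-1) sf).
by under eq_fun do rewrite mulN1r.
Qed.

Lemma test_glue b r : (forall x, x \in r -> test (b x)) -> test (glue b r).
Proof.
elim: r => [_|x r IH H] /=.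
  split; first exact: smooth_cst.
  apply: (subclosed_compact _ compact0); first exact: closed_closure.
  by apply: fsupp_sub; first exact: closed0.
have tx : test (b x) by apply: H; rewrite mem_head.
apply: testD => //; apply: testM; first by apply: smooth_onem; case: tx.
by apply: IH => z zr; apply: H; rewrite inE zr orbT.
Qed.

(** Finitely many of the open sets on which a local bump equals 1 cover [K], and [glue] is 1
    wherever one of its bumps is. This serves both as a source of cutoffs and as a partition of
    unity. *)
Lemma compact_glue (K : set (R3 R)) (U : R3 R -> set (R3 R)) : compact K ->
  (forall x, K x -> nbhs x (U x)) ->
  exists b (r : seq (R3 R)), [/\ forall x, x \in r -> K x,
    forall x, x \in r -> test (b x) /\ fsupp (b x) `<=` U x &
    K `<=` interior [set y | glue b r y = 1]].
Proof.
move=> cK KU.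
have H x : exists p : (R3 R -> R) * set (R3 R), K x -> [/\ test p.1,
    fsupp p.1 `<=` U x, open p.2, p.2 x & forall y, p.2 y -> p.1 y = 1].
  have [/KU/local_bump[b [V HV]]|NK] := pselect (K x); first by exists (b, V).
  by exists (fun=> 0, set0).
have [p Hp] := choice H.
(* Products are not canonically pointed topological spaces. *)
pose T : ptopologicalType :=
  HB.pack (R * R * R)%type (Pointed.on (R * R * R)%type) (Topological.on (R * R * R)%type).
have : @cover_compact T K by rewrite -compact_cover.
move=> /(_ (R3 R) K (fun x => (p x).2)) [x Kx|x Kx|D DK KD].
- by have [] := Hp x Kx.
- by exists x => //; have [] := Hp x Kx.
have memD x : x \in finmap.enum_fset D -> K x by move=> xD; apply: set_mem; exact: DK.
exists (fun x => (p x).1), (finmap.enum_fset D); split=> // [x /memD/Hp[]//|y /KD[x /= xD pxy]].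
have [_ _ oV _ V1] := Hp x (memD x xD).
rewrite /interior; apply: filterS (open_nbhs_nbhs (conj oV pxy)) => z pz /=.
by apply: (glue1 xD); exact: V1.
Qed.

Lemma exists_cutoff (K : set (R3 R)) : compact K -> exists chi, cutoff K chi.
Proof.
move=> cK; have [x _|b [r [_ Hr Kr]]] := @compact_glue K (fun=> setT) cK.
  exact: filterT.
by exists (glue b r); split=> //; apply: test_glue => x /Hr[].
Qed.

Lemma closed_dsupp (l : @functional R) : closed (dsupp l).
Proof. by apply: closed_bigI => S [[]]. Qed.

(** [dsupp l] is an intersection of closed sets off each of which [l] vanishes; that [l] vanishes
    off the intersection itself has to be proved. A partition of unity cuts [phi] into pieces that
    each avoid one of these sets. *)
Lemma dsupp_vanish (l : @functional R) phi : linear_on test l -> test phi ->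
  fsupp phi `&` dsupp l = set0 -> l phi = 0.
Proof.
move=> ll tphi disj.
have H x : exists S : set (R3 R), fsupp phi x -> [/\ closed S, ~ S x &
    forall psi, test psi -> fsupp psi `&` S = set0 -> l psi = 0].
  have [px|Npx] := pselect (fsupp phi x); last by exists set0.
  have : ~ dsupp l x by move=> lx; have : set0 x by rewrite -disj.
  by move=> /existsNP[S /not_implyP[[[cS HS] _] NSx]]; exists S.
have [S HS] := choice H.
have [x px|b [r [rK Hr Kr]]] := @compact_glue (fsupp phi) (fun x => ~` S x) tphi.2.
  by have [cS NSx _] := HS x px; apply: open_nbhs_nbhs; split=> //; exact: closed_openC.
(* [psi] is general because peeling off the first bump [b x] passes from [psi] to
   [(1 - b x) * psi]. *)
have key psi : test psi -> l (fun y => glue b r y * psi y) = 0.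
  elim: r rK Hr {Kr} psi => [_ _|x r IH rK Hr] psi tpsi /=.
    have := ll (-1) psi psi tpsi tpsi.
    under [X in l X = _ -> _]eq_fun do rewrite mulN1r addNr.
    rewrite mulN1r addNr => H0.
    by under eq_fun do rewrite mul0r.
  have xr : x \in x :: r by rewrite mem_head.
  have [tx sx] := Hr x xr; have [_ _ Sx] := HS x (rK x xr).
  have t1 : test (fun y => psi y * b x y) by apply: testM => //; case: tpsi.
  have t2 : test (fun y => (1 - b x y) * psi y).
    by apply: testM => //; apply: smooth_onem; case: tx.
  have sr z : z \in r -> z \in x :: r by rewrite inE => ->; rewrite orbT.
  have t3 : test (fun y => glue b r y * ((1 - b x y) * psi y)).
    apply: testM => //.
    by have [] : test (glue b r) by apply: test_glue => z /sr/Hr[].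
  have -> : (fun y => (b x y + (1 - b x y) * glue b r y) * psi y) =
     (fun y => 1 * (psi y * b x y) + glue b r y * ((1 - b x y) * psi y)).
    by apply/funext => y; ring.
  rewrite (ll 1 _ _ t1 t3) IH//; last 2 first.
  - by move=> z /sr/rK.
  - by move=> z /sr/Hr.
  rewrite addr0 mul1r; apply: Sx => //; apply/seteqP; split=> // y [/fsuppM/sx Ny Sy].
  exact: Ny.
rewrite -(key phi tphi); congr l; apply/funext => y.
have [/Kr/interior_subset /= ->|/fsupp_out ->] := pselect (fsupp phi y).
  by rewrite mul1r.
by rewrite mulr0.
Qed.

(** Two cutoffs are both 1 near [dsupp l], so the support of their difference misses it. Allowing a
    larger compact set [A] lets functionals with different supports share one cutoff. *)
Lemma smooth_pairing_cutoff (l : @functional R) (A : set (R3 R)) chi :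
  linear_on test l -> compact A -> dsupp l `<=` A -> cutoff A chi ->
  smooth_pairing l (fun=> 1) = l chi.
Proof.
move=> ll cA lA [tchi Achi]; rewrite /smooth_pairing.
have cl : compact (dsupp l) by apply: (subclosed_compact _ cA) => //; exact: closed_dsupp.
have [chi0 H0] := exists_cutoff cl.
have [tz sz] : cutoff (dsupp l) (xget (fun=> 0) (cutoff (dsupp l))).
  exact: (xgetPex _ (ex_intro _ chi0 H0)).
set z := xget _ _ in tz sz *.
under eq_fun do rewrite mulr1.
have td : test (fun x => -1 * chi x + z x) by apply: testD => //; exact: testZ.
have : l (fun x => -1 * chi x + z x) = 0.
  apply: dsupp_vanish => //; apply/seteqP; split=> // x [dx lx].
  have Ox : nbhs x ([set x | z x = 1] `&` [set x | chi x = 1]).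
    by apply: filterI; [exact: sz|exact: Achi (lA x lx)].
  have [y [/= dy [zy cy]]] := dx _ Ox.
  by move: dy; rewrite zy cy; rewrite mulN1r addNr eqxx.
by rewrite ll// mulN1r addrC => /eqP; rewrite subr_eq0 => /eqP.
Qed.

End supports.

(** * Comparison of bumps *)

Section bump_comparison.
Context {R : realType}.
Local Notation leb := (@lebesgue_measure R).
Local Notation mu := (leb3 R).
Implicit Types (f g w : R3 R -> R) (x : R3 R) (i j : 'I_3) (p : R -> R).

Definition compact1 p := exists r, forall t, ~~ (- r < t < r) -> p t = 0.

Lemma compact1_sub (c : R) p : compact1 p -> compact1 (fun t => c * p t).
Proof. by move=> [r H]; exists r => t /H ->; rewrite mulr0. Qed.

Lemma compact1_plateau (s a b : R) : 0 <= s -> compact1 (plateau s a b).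
Proof.
move=> s0; exists (Num.max `|a| `|b|) => t Nt; apply: plateau_out => //.
apply: contra Nt => /andP[at_ tb]; apply/andP; split.
  rewrite ltrNl; apply: (@lt_le_trans _ _ (- a)); first by rewrite ltrN2.
  by rewrite le_max -normrN ler_norm.
by rewrite (lt_le_trans tb)// le_max (ler_norm b) orbT.
Qed.

Lemma test_tensor_compact1 (q : 'I_3 -> R -> R) : (forall i, smooth1 (q i)) ->
  (forall i, compact1 (q i)) -> test (tensor q).
Proof.
by move=> sq /choice[r Hr]; apply: (@test_tensor _ _ (fun i => - r i) r).
Qed.

Lemma partial_tensor (q dq : 'I_3 -> R -> R) x : (forall i, smooth1 (q i)) ->
  (forall i t, is_derive t (1 : R) (q i) (dq i t)) ->
  [/\ partial i0 (tensor q) x = dq i0 (proj3 i0 x) * q i1 (proj3 i1 x) * q i2 (proj3 i2 x),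
      partial i1 (tensor q) x = q i0 (proj3 i0 x) * dq i1 (proj3 i1 x) * q i2 (proj3 i2 x) &
      partial i2 (tensor q) x = q i0 (proj3 i0 x) * q i1 (proj3 i1 x) * dq i2 (proj3 i2 x)].
Proof.
move=> sq dq_.
have s i : smooth (q i \o proj3 i) by exact: smooth_proj3.
have E i : partial i (tensor q) x =
    (q i0 (proj3 i0 x) * q i1 (proj3 i1 x)) * ((i == i2)%:R * dq i2 (proj3 i2 x)) +
    q i2 (proj3 i2 x) * (q i0 (proj3 i0 x) * ((i == i1)%:R * dq i1 (proj3 i1 x)) +
      q i1 (proj3 i1 x) * ((i == i0)%:R * dq i0 (proj3 i0 x))).
  have -> : tensor q = fun x => (q i0 \o proj3 i0) x * (q i1 \o proj3 i1) x * (q i2 \o proj3 i2) x.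
    by [].
  rewrite (partialM i (smoothM (s i0) (s i1)) (s i2)) (partialM i (s i0) (s i1)).
  by rewrite !(partial_proj3 _ _ (dq_ _)).
by split; rewrite E /=; ring.
Qed.

(* The one-dimensional functions [m q * p - m p * q], with [m] the integral,
   have compactly supported primitives; telescoping over the three factors
   exhibits the difference of the normalised tensors as a divergence. *)
Lemma tensor_divergence (p q : 'I_3 -> R -> R) :
  let m (h : 'I_3 -> R -> R) i := \int[leb]_t h i t in
  (forall i, smooth1 (p i)) -> (forall i, compact1 (p i)) ->
  (forall i, smooth1 (q i)) -> (forall i, compact1 (q i)) ->
  exists2 chi, forall i, test (chi i) &
    divergence chi = fun x => m q i0 * m q i1 * m q i2 * tensor p x -
                              m p i0 * m p i1 * m p i2 * tensor q x.
Proof.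
move=> m sp cp sq cq.
have H0 i : exists H : R -> R, [/\ smooth1 H, compact1 H &
    forall t, is_derive t (1 : R) H (m q i * p i t - m p i * q i t)].
  have [r Hr] := cp i; have [r' Hr'] := cq i.
  pose r2 := Num.max r r'.
  have out t : ~~ (- r2 < t < r2) -> ~~ (- r < t < r) /\ ~~ (- r' < t < r').
    rewrite !negb_and -!leNgt /r2 => /orP[|]; [rewrite lerNr|]; rewrite ge_max => /andP[H1 H2].
      by rewrite lerNr H1 lerNr H2.
    by rewrite H1 H2 !orbT.
  have p2 t : ~~ (- r2 < t < r2) -> p i t = 0 by move=> /out[/Hr].
  have q2 t : ~~ (- r2 < t < r2) -> q i t = 0 by move=> /out[_ /Hr'].
  have ip := integrable_compact1 (smooth1_continuous (sp i)) p2.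
  have iq := integrable_compact1 (smooth1_continuous (sq i)) q2.
  have [|||H [sH dH HH]] := @primitive_compact R (fun t => m q i * p i t + (- m p i) * q i t) r2.
  - by apply: smooth1D; apply: smooth1M => //; exact: smooth1_cst.
  - by move=> t Nt; rewrite p2// q2// !mulr0 addr0.
  - have iP : leb.-integrable setT (EFin \o (fun t => m q i * p i t)).
      by apply: eq_integrable (integrableZl measurableT (m q i) ip).
    have iQ : leb.-integrable setT (EFin \o (fun t => (- m p i) * q i t)).
      by apply: eq_integrable (integrableZl measurableT (- m p i) iq).
    by rewrite RintegralD// RintegralZl// RintegralZl// /m; ring.
  exists H; split=> //; first by exists r2.
  by move=> t; have := dH t; rewrite mulNr.
have [H HH] := choice H0.
have sH i : smooth1 (H i) by have [] := HH i.
have cH i : compact1 (H i) by have [] := HH i.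
have dH i t : is_derive t (1 : R) (H i) (m q i * p i t - m p i * q i t).
  by have [_ _] := HH i; exact.
(* In component [j] the factors before [j] have already been exchanged for those of [q], factor [j]
   is the primitive, and the later ones are still those of [p]; this is what makes the divergence
   telescope. *)
pose A j i : R -> R := if (i < j)%N then fun t => m p i * q i t
  else if i == j then H i else fun t => m q i * p i t.
have sA j i : smooth1 (A j i).
  rewrite /A; case: ifP => _; last case: ifP => _ //;
    by apply: smooth1M => //; exact: smooth1_cst.
have cA j i : compact1 (A j i).
  by rewrite /A; case: ifP => _; last case: ifP => _ //; exact: compact1_sub.
exists (fun j => tensor (A j)) => [j|]; first exact: test_tensor_compact1.
have dA j i : exists dq, (forall t, is_derive t (1 : R) (A j i) (dq t)).
  by have [d _ Hd] := smooth1_derive (sA j i); exists d.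
(* Component [j] is differentiated along axis [j] alone, so the derivative is made explicit on the
   diagonal and merely exists elsewhere. *)
have D j i : exists dq, (forall t, is_derive t (1 : R) (A j i) (dq t)) /\
   (i = j -> dq = fun t => m q i * p i t - m p i * q i t).
  have [->|ij] := eqVneq i j.
    by exists (fun t => m q j * p j t - m p j * q j t); rewrite /A ltnn eqxx; split.
  have [d Hd] := dA j i; exists d; split=> // E.
  by rewrite E eqxx in ij.
pose dq j i := sval (cid (D j i)).
have Hdq j i := svalP (cid (D j i)).
have dq1 j i t : is_derive t (1 : R) (A j i) (dq j i t) by have [Hd _] := Hdq j i; exact: Hd.
have dq2 j : dq j j = fun t => m q j * p j t - m p j * q j t by have [_ Hd] := Hdq j j; exact: Hd.
apply/funext => x; rewrite /divergence.
have [-> _ _] := partial_tensor x (sA i0) (dq1 i0).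
have [_ -> _] := partial_tensor x (sA i1) (dq1 i1).
have [_ _ ->] := partial_tensor x (sA i2) (dq1 i2).
by rewrite !dq2 /A /tensor /=; ring.
Qed.

(** The flanks have width [d / 4], so the plateau is 1 on an interval of length [d / 2]. *)
Lemma plateau_integral_gt0 (x d : R) : 0 < d ->
  0 < \int[leb]_t plateau (4 / d) (x - d / 2) (x + d / 2) t.
Proof.
move=> d0; have s0 : 0 < 4 / d by rewrite divr_gt0.
pose I := `[x - d / 4, x + d / 4]%classic : set (measurableTypeR R).
have mI : measurable I by exact: measurable_itv.
have lI : leb I = (d / 2)%:E.
  rewrite /I lebesgue_measure_itv/= lte_fin ifT; last by lra.
  by rewrite -EFinB; congr EFin; lra.
have [r Hr] := @compact1_plateau (4 / d) (x - d / 2) (x + d / 2) (ltW s0).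
have ip := integrable_compact1 (smooth1_continuous (@smooth1_plateau R _ _ _)) Hr.
have iI : leb.-integrable setT (EFin \o (cst (1 : R) \_ I)).
  rewrite -restrict_EFin; apply/integrable_restrict => //.
  rewrite setTI; apply: measurable_bounded_integrable => //.
    by rewrite [ltLHS]lI ltry.
  exact: bounded_cst.
apply: (@lt_le_trans _ _ (\int[leb]_t (cst (1 : R) \_ I) t)).
  by rewrite -Rintegral_mkcond Rintegral_cst// [X in fine X]lI /= mul1r divr_gt0.
apply: le_Rintegral => // t _; rewrite patchE; case: ifPn => [|_].
  rewrite inE /I /= in_itv/= => /andP[? ?].
  rewrite plateau_in// invf_div; apply/andP; split; lra.
exact: plateau_ge0.
Qed.

End bump_comparison.

(** * The variational argument *)

Section variation.
Context {R : realType}.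
Local Notation mu := (leb3 R).
Implicit Types (f g w : R3 R -> R) (x : R3 R) (i j : 'I_3) (l : @functional R).

Lemma integral_divergence (chi : 'I_3 -> R3 R -> R) : (forall i, test (chi i)) ->
  \int[mu]_x divergence chi x = 0.
Proof.
move=> tc; have I i := integrable_test (test_partial i (tc i)).
have ID : mu.-integrable setT (EFin \o (fun x : mR3 R =>
    partial i0 (chi i0) x + partial i1 (chi i1) x)).
  by apply: eq_integrable (integrableD measurableT (I i0) (I i1)).
under eq_Rintegral do rewrite /divergence.
rewrite RintegralD//; last exact: I.
rewrite RintegralD//; try exact: I.
by rewrite !Rintegral_partial// !addr0.
Qed.

Lemma kformC (k : R) (E : set (R3 R)) f g : kform k E f g = kform k E g f.
Proof.
have A : \int[mu]_x (\sum_(i < 3) grad f i x * grad g i x) =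
    \int[mu]_x (\sum_(i < 3) grad g i x * grad f i x).
  by apply: eq_Rintegral => x _; apply: eq_bigr => i _; rewrite mulrC.
have B : \int[mu]_(x in E) (f x * g x) = \int[mu]_(x in E) (g x * f x).
  by apply: eq_Rintegral => x _; rewrite mulrC.
by rewrite /kform A B.
Qed.

Lemma quadratic_ge0_linear_eq0 (a b : R) :
  (forall t, 0 <= 2 * t * a + t ^+ 2 * b) -> a = 0.
Proof.
move=> H; apply/eqP; apply: contraT => a0.
have B0 : 0 < `|b| + 1 by rewrite ltr_wpDl.
(* With this [t] the expression is a positive multiple of [b - 2 * (|b| + 1)], which is negative for
   [b] of either sign. *)
have := H (- a / (`|b| + 1)).
have -> : 2 * (- a / (`|b| + 1)) * a + (- a / (`|b| + 1)) ^+ 2 * b =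
    (a ^+ 2 / (`|b| + 1) ^+ 2) * (b - 2 * (`|b| + 1)).
  by field; rewrite gt_eqF.
rewrite pmulr_rge0; last by apply: divr_gt0; [rewrite exprn_even_gt0|exact: exprn_gt0].
by have := ler_norm b; have := normr_ge0 b; lra.
Qed.

Lemma perturbation (E : set (R3 R)) (q t : R) l (chi : 'I_3 -> R3 R -> R) :
  compact E -> Ch E q l -> (forall i, test (chi i)) ->
  (forall x, ~ E x -> divergence chi x = 0) ->
  let m := density_functional (divergence chi) in
  let l' := fun f => l f + t * m f in
  Ch E q l' /\ forall f, dirichlet f -> extension l' f = extension l f + t * m f.
Proof.
move=> cE [[[ll cl] [L CL]] lE lq] tc w0 m l'.
have [[[lm cm] _] Cm] := divergence_dual tc; rewrite -/m in lm cm Cm.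
have tw := test_divergence tc.
have [T1 N1 [M1 B1]] : continuous_extension l (extension l).
  exact: (xgetPex _ (ex_intro _ L CL)).
have [T2 N2 [M2 B2]] := Cm.
have Cl' : continuous_extension l' (fun f => extension l f + t * m f).
  split=> [phi tphi|a f g df dg|].
  - by rewrite T1.
  - by rewrite N1// N2//; ring.
  - exists (M1 + `|t| * M2) => f df.
    rewrite (le_trans (ler_normD _ _))// mulrDl lerD ?B1// normrM -mulrA.
    by rewrite ler_wpM2l ?B2.
have ll' : linear_on test l' by move=> a f g tf tg; rewrite /l' ll// lm//; ring.
have dl' : Defs.distribution l'.
  split=> // phi f tphi tf pf; apply: cvgD; first exact: cl.
  by apply: cvgMr; exact: cm.
have cdl : closed E by apply: compact_closed => //; exact: norm_hausdorff.
have w_fsupp phi : fsupp phi `&` E = set0 -> m phi = 0.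
  move=> phiE; rewrite /m /density_functional.
  under eq_Rintegral => x _.
    have -> : phi x * divergence chi x = 0.
      have [Ex|/w0 ->] := pselect (E x); last by rewrite mulr0.
      rewrite fsupp_out ?mul0r// => px.
      by have : set0 x by rewrite -phiE.
    over.
  by rewrite Rintegral_cst// mul0r.
have sE : dsupp l' `<=` E.
  move=> x; apply; split=> //; split=> // phi tphi phiE.
  rewrite /l' w_fsupp// mulr0 addr0; apply: dsupp_vanish => //.
  by apply/seteqP; split=> // y [py /lE Ey]; rewrite -phiE.
split; last by move=> f df; exact: (extensionP Cl' df).
(* A single cutoff of [E] computes the charges of both [l] and [l']; it equals 1 wherever the
   divergence is nonzero, so the added charge is the integral of the divergence. *)
have [eta Heta] := exists_cutoff cE.
split=> //; first by split=> //; eexists; exact: Cl'.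
rewrite (smooth_pairing_cutoff ll' cE sE Heta) /l' -(smooth_pairing_cutoff ll cE lE Heta) lq.
rewrite /m /density_functional -[RHS]addr0; congr (_ + _).
rewrite -(mulr0 t) -(integral_divergence tc); congr (_ * _).
apply: eq_Rintegral => x _.
have [Ex|/w0 ->] := pselect (E x); last by rewrite mulr0.
by have /interior_subset /= -> := Heta.2 x Ex; rewrite mul1r.
Qed.

Lemma potentialP (E : set (R3 R)) (k : R) l : potentials_exist_unique k E ->
  dirichlet_dual l -> is_potential k E l (potential k E l).
Proof. by move=> hpot /hpot[U [HU _]]; exact: (xgetPex _ (ex_intro _ U HU)). Qed.

Lemma equilibrium_stationary (E : set (R3 R)) (k q : R) l (chi : 'I_3 -> R3 R -> R) :
  compact E -> potentials_exist_unique k E -> equilibrium k E q l ->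
  (forall i, test (chi i)) -> (forall x, ~ E x -> divergence chi x = 0) ->
  density_functional (divergence chi) (potential k E l) = 0.
Proof.
move=> cE hpot [lE lmin] tc w0.
set m := density_functional (divergence chi).
have [dm Cm] := divergence_dual tc; rewrite -/m in dm Cm.
have [dUl HUl] : is_potential k E l (potential k E l) by apply: potentialP => //; case: lE.
have [dUm HUm] := potentialP hpot dm.
have em f : dirichlet f -> extension m f = m f by move=> df; exact: extensionP Cm df.
apply: (@quadratic_ge0_linear_eq0 _ (m (potential k E m))) => t.
have [Cl' El'] := perturbation t cE lE tc w0; rewrite -/m in Cl' El'.
set l' := fun f => l f + t * m f in Cl' El'.
have [dV HV] : is_potential k E l' (potential k E l') by apply: potentialP => //; case: Cl'.
have : potential_energy k E l <= potential_energy k E l'.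
  by rewrite -lee_fin lmin; apply: ereal_inf_lbound; exists l'.
rewrite /potential_energy.
(* Reciprocity: symmetry of the form exchanges a functional with the potential of another. The
   energy of [l'] becomes that of [l] plus [2 * t * m (potential k E l) + t ^+ 2 * m (potential k E
   m)], without relating the chosen potential of [l'] to the other two. *)
have E1 : extension l (potential k E l') = extension l' (potential k E l).
  by rewrite (HUl _ dV) (HV _ dUl); exact: kformC.
have E2 : m (potential k E l') = extension l' (potential k E m).
  by rewrite -(em _ dV) (HUm _ dV) (HV _ dUm); exact: kformC.
have E3 : extension l (potential k E m) = m (potential k E l).
  by rewrite -(em _ dUl) (HUl _ dUm) (HUm _ dUl); exact: kformC.
rewrite (El' _ dV) E1 E2 (El' _ dUl) (El' _ dUm) E3.
move: (extension l _) (m (potential k E l)) (m (potential k E m)) => u v w.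
lra.
Qed.

(** By Fubini's theorem this is the integral of [box_bump s a b]; the product is the form in which
    [tensor_divergence] delivers its coefficients. *)
Definition plateau_mass (s : R) (a b : 'I_3 -> R) : R :=
  \int[@lebesgue_measure R]_t plateau s (a i0) (b i0) t *
  \int[@lebesgue_measure R]_t plateau s (a i1) (b i1) t *
  \int[@lebesgue_measure R]_t plateau s (a i2) (b i2) t.

Lemma Rintegral_mul_lin2 (c d : R) f g h : locally_integrable3 f -> test g -> test h ->
  \int[mu]_x (f x * (c * g x - d * h x)) =
  c * \int[mu]_x (f x * g x) - d * \int[mu]_x (f x * h x).
Proof.
move=> lf tg th; have ig := integrable_loc_test lf tg.
have ih := integrable_loc_test lf th.
have icg : mu.-integrable setT (EFin \o (fun x : mR3 R => c * (f x * g x))).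
  by apply: eq_integrable (integrableZl measurableT c ig).
have idh : mu.-integrable setT (EFin \o (fun x : mR3 R => d * (f x * h x))).
  by apply: eq_integrable (integrableZl measurableT d ih).
rewrite -(RintegralZl c measurableT ig) -(RintegralZl d measurableT ih).
rewrite -(RintegralB measurableT icg idh).
by apply: eq_Rintegral => x _; ring.
Qed.

Lemma locally_integrable3_cst (c : R) : locally_integrable3 (fun=> c).
Proof. by apply: locally_integrable_continuous => x; exact: cvg_cst. Qed.

(** Both identities come from one field: its divergence pairs to 0 with the potential by
    stationarity, and to 0 with the constant 1 because integrals of partial derivatives of test
    functions vanish. *)
Lemma equilibrium_box_bump (E : set (R3 R)) (k q s s' : R) l (a b a' b' : 'I_3 -> R) :
  compact E -> potentials_exist_unique k E -> equilibrium k E q l ->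
  0 < s -> cbox a b `<=` E -> 0 < s' -> cbox a' b' `<=` E ->
  plateau_mass s' a' b' * \int[mu]_x (potential k E l x * box_bump s a b x) =
    plateau_mass s a b * \int[mu]_x (potential k E l x * box_bump s' a' b' x) /\
  plateau_mass s' a' b' * \int[mu]_x box_bump s a b x =
    plateau_mass s a b * \int[mu]_x box_bump s' a' b' x.
Proof.
move=> cE hpot hl s0 abE s0' abE'.
set U := potential k E l.
have tB := test_box_bump a b (ltW s0); have tB' := test_box_bump a' b' (ltW s0').
have [||||chi tchi Echi] := @tensor_divergence R (fun i => plateau s (a i) (b i))
  (fun i => plateau s' (a' i) (b' i)).
- by move=> i; exact: smooth1_plateau.
- by move=> i; exact/compact1_plateau/ltW.
- by move=> i; exact: smooth1_plateau.
- by move=> i; exact/compact1_plateau/ltW.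
have {}Echi : divergence chi = fun x => plateau_mass s' a' b' * box_bump s a b x -
  plateau_mass s a b * box_bump s' a' b' x by [].
move: (plateau_mass s' a' b') (plateau_mass s a b) Echi => M M' Echi.
have w0 x : ~ E x -> divergence chi x = 0.
  move=> NEx; have out r c d : 0 < r -> cbox c d `<=` E -> box_bump r c d x = 0.
    move=> r0 H; apply: box_bump_out; first exact: ltW.
    by move=> /obox_sub_cbox/H.
  by rewrite Echi (out s a b s0 abE) (out s' a' b' s0' abE') !mulr0 subrr.
have [dU _] : is_potential k E l U by apply: potentialP => //; case: hl => -[].
have H1 := integral_divergence tchi.
have H2 := equilibrium_stationary cE hpot hl tchi w0.
split; apply/eqP; rewrite -subr_eq0.
  rewrite -(Rintegral_mul_lin2 M M' (dirichlet_locally_integrable dU) tB tB').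
  by rewrite -[X in _ == X]H2 /density_functional Echi.
rewrite -[X in _ == X]H1 Echi.
have one (f : R3 R -> R) : \int[mu]_x (1 * f x) = \int[mu]_x f x.
  by apply: eq_Rintegral => x _; rewrite mul1r.
have := Rintegral_mul_lin2 M M' (locally_integrable3_cst 1) tB tB'.
by rewrite !one => ->.
Qed.

Lemma potential_constant (E : set (R3 R)) (q k : R) l :
  compact E -> potentials_exist_unique k E -> equilibrium k E q l ->
  exists c : R, {ae mu, forall x, interior E x -> potential k E l x = c}.
Proof.
move=> cE hpot hl; set U := potential k E l.
have oE : open (interior E) by exact: open_interior.
have [[x0 Ex0]|NE] := pselect (interior E !=set0); last first.
  by exists 0; apply: aeW => x Ex; case: NE; exists x.
have [dU _] : is_potential k E l U by apply: potentialP => //; case: hl => -[].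
have lU := dirichlet_locally_integrable dU.
have [d d0 dE] := nbhs_obox (oE x0 Ex0).
(* The reference bump around [x0] has the proportions of [plateau_integral_gt0], which makes its
   mass positive and allows cancellation. *)
pose s0 := 4 / d; have s00 : 0 < s0 by rewrite divr_gt0.
pose a0 i := proj3 i x0 - d / 2; pose b0 i := proj3 i x0 + d / 2.
have abE0 : cbox a0 b0 `<=` E.
  move=> y Hy; apply: interior_subset; apply: dE => i; have := Hy i.
  rewrite /a0 /b0 => /andP[? ?].
  by rewrite distrC ltr_distl; apply/andP; split; lra.
have : 0 < plateau_mass s0 a0 b0.
  by apply: mulr_gt0; [apply: mulr_gt0|]; exact: plateau_integral_gt0.
have key s a b (sgt0 : 0 < s) (abE : cbox a b `<=` interior E) :=
  @equilibrium_box_bump E k q s s0 l a b a0 b0 cE hpot hl sgt0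
    (subset_trans abE (@interior_subset _ E)) s00 abE0.
move: (plateau_mass s0 a0 b0) key => m0 key /lt0r_neq0 m0n0.
move: (\int[mu]_x box_bump s0 a0 b0 x) (\int[mu]_x (potential k E l x * box_bump s0 a0 b0 x)) key => J K key.
(* If the reference bump had integral 0, so would all bumps in the interior of
   [E], which would then be negligible. *)
have [J0|J0] := eqVneq J 0.
  exists 0.
  case: (@du_bois_reymond R (interior E) (fun=> 1) oE (locally_integrable3_cst 1)).
    move=> s a b sgt0 abE; have [_ K2] := key s a b sgt0 abE.
    under eq_Rintegral do rewrite mul1r.
    by apply: (mulfI m0n0); rewrite K2 J0 !mulr0.
  move=> N [mN N0 HN]; exists N; split=> // x /= Nx; apply: HN => /= H.
  by apply: Nx => /H /eqP; rewrite oner_eq0.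
(* The mean of the potential over the reference bump: [K] is its integral against that bump and [J]
   the integral of the bump. *)
exists (K / J); have lc := locally_integrable3_cst (K / J).
case: (@du_bois_reymond R (interior E) (fun x => U x - K / J) oE (locally_integrable3B lU lc)).
  move=> s a b sgt0 abE; have [K1 K2] := key s a b sgt0 abE.
  have tB := test_box_bump a b (ltW sgt0).
  under eq_Rintegral do rewrite mulrBl.
  rewrite (RintegralB measurableT (integrable_loc_test lU tB) (integrable_loc_test lc tB)).
  rewrite (RintegralZl (K / J) measurableT (integrable_test tB)).
  apply: (mulfI m0n0); rewrite mulr0 mulrBr K1 (mulrCA m0) K2.
  by move: (plateau_mass s a b) => M; field.
move=> N [mN N0 HN]; exists N; split=> // x /= Nx; apply: HN => /= H.
by apply: Nx => /H /eqP; rewrite subr_eq0 => /eqP.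
Qed.

End variation.

Theorem theorem18 (R : realType) (E : set (R3 R)) (q k : R)
    (lk : @functional R) (hE : compact E) (hk0 : 0 < k)
    (hk : (k%:E <= kmax E)%E) (hpot : potentials_exist_unique k E)
    (hlk : equilibrium k E q lk) :
  exists c : R,
    {ae leb3 R, forall x, interior E x -> potential k E lk x = c}.
Proof. exact: potential_constant hE hpot hlk. Qed.
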